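(* Let $d,r:\mathbb{N}\to\mathbb{N}$ be functions such that $d$ is nondecreasing, takes only prime values at least $5$, $r$ is strictly increasing, and $3r(n)\le d(n)$ for all $n$. Let $\alpha_n=(1\;2\;\cdots\;d(n))$, $\beta_n=(1\;(1+r(n))\;(1+2r(n)))$, $\alpha=(\alpha_n)_n,\beta=(\beta_n)_n\in\prod_n\mathrm{Alt}(d(n))$, $G=\langle\alpha,\beta\rangle$, and let $L_\infty$ be the normal closure of $\beta$ in $G$. Let $\mu$ be an ergodic invariant random subgroup of $G$ whose support is contained in $\mathrm{Sub}(L_\infty)$. Then $\mu$ is cosofic in $G$.
   Context: $\mathbb{N}=\{1,2,\dots\}$. For a countable group $\Gamma$, $\mathrm{Sub}(\Gamma)\subseteq\{0,1\}^\Gamma$ is the space of subgroups with the product topology, on which $\Gamma$ acts by conjugation. An invariant random subgroup (IRS) is a conjugation-invariant Borel probability measure on $\mathrm{Sub}(\Gamma)$; the IRS form a compact convex set under the weak$^*$ topology, and an IRS is ergodic if it is an extreme point of this set. An IRS is finite-index if it is an atomic measure supported on finite-index subgroups, and cosofic if it is a weak$^*$ limit of finite-index IRS. *)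

(* Defs.v *)
From HB Require Import structures.
From mathcomp Require Import all_boot all_order all_algebra all_fingroup.
From mathcomp Require Import all_classical all_reals all_analysis.
Set Implicit Arguments. Unset Strict Implicit. Unset Printing Implicit Defensive.
Import Order.TTheory GRing.Theory Num.Theory.
Import numFieldNormedType.Exports.
Local Open Scope classical_set_scope.
Local Open Scope ring_scope.

Notation SubSp T := {ptws T -> bool}.

Definition BorelSp (T : Type) := g_sigma_algebraType (@open (SubSp T)).

Definition is_subgroup (T : Type) (mul : T -> T -> T) (inv : T -> T) (one : T)
  (H : T -> bool) : Prop :=
  H one /\ (forall x y, H x -> H y -> H (mul x y)) /\ (forall x, H x -> H (inv x)).

Definition conj_act (T : Type) (mul : T -> T -> T) (inv : T -> T) (g : T)
  (H : T -> bool) : T -> bool := fun x => H (mul (mul (inv g) x) g).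

Definition finite_index (T : Type) (mul : T -> T -> T) (inv : T -> T)
  (H : T -> bool) : Prop :=
  exists (n : nat) (x : nat -> T), forall g, exists i, (i < n)%N /\ H (mul (inv (x i)) g).

Definition IRS (R : realType) (T : Type) (mul : T -> T -> T) (inv : T -> T) (one : T)
  (mu : probability (BorelSp T) R) : Prop :=
  mu [set H | is_subgroup mul inv one H] = 1%E /\
  forall (g : T) (A : set (BorelSp T)), measurable A ->
    mu (conj_act mul inv g @^-1` A) = mu A.

(* ergodic = extreme point of the convex set of IRS *)
Definition ergodic_IRS (R : realType) (T : Type) (mul : T -> T -> T) (inv : T -> T) (one : T)
  (mu : probability (BorelSp T) R) : Prop :=
  IRS mul inv one mu /\
  forall (nu1 nu2 : probability (BorelSp T) R) (t : R), 0 < t < 1 ->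
    IRS mul inv one nu1 -> IRS mul inv one nu2 ->
    (forall A : set (BorelSp T), measurable A ->
       mu A = (t%:E * nu1 A + (1 - t)%:E * nu2 A)%E) ->
    forall A : set (BorelSp T), measurable A -> nu1 A = nu2 A.

Definition finite_index_IRS (R : realType) (T : Type) (mul : T -> T -> T) (inv : T -> T)
  (one : T) (mu : probability (BorelSp T) R) : Prop :=
  IRS mul inv one mu /\
  exists (c : nat -> R) (Hs : nat -> (T -> bool)),
    (forall i, 0 <= c i) /\
    (forall i, is_subgroup mul inv one (Hs i) /\ finite_index mul inv (Hs i)) /\
    forall A : set (BorelSp T), measurable A ->
      mu A = (\sum_(0 <= i <oo) ((c i)%:E * (\1_A (Hs i : BorelSp T))%:E))%E.

Definition Efun (T : Type) (R : realType) (f : SubSp T -> R) : BorelSp T -> \bar R :=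
  fun x => (f x)%:E.

Definition cosofic (R : realType) (T : Type) (mul : T -> T -> T) (inv : T -> T) (one : T)
  (mu : probability (BorelSp T) R) : Prop :=
  exists nu : nat -> probability (BorelSp T) R,
    (forall k, finite_index_IRS mul inv one (nu k)) /\
    forall f : SubSp T -> R, continuous f ->
      (fun k => \int[nu k]_x Efun f x)%E @ \oo --> (\int[mu]_x Efun f x)%E.

(* Points {1,...,d} are represented by 'I_d = {0,...,d-1}.             *)

Definition PG (d : nat -> nat) := forall n, {perm 'I_(d n)}.

Definition pmul d (x y : PG d) : PG d := fun n => (x n * y n)%g.
Definition pinv d (x : PG d) : PG d := fun n => ((x n)^-1)%g.
Definition pone d : PG d := fun n => 1%g.

(* the d-cycle (0 1 ... d-1), i.e. (1 2 ... d) *)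
Definition cycle_perm (m : nat) : {perm 'I_m} := perm (@ordS_inj m).

(* the 3-cycle a -> b -> c -> a (identity if some point is out of range) *)
Definition cyc3 (m a b c : nat) : {perm 'I_m} :=
  match (insub a : option 'I_m), (insub b : option 'I_m), (insub c : option 'I_m) with
  | Some a', Some b', Some c' => (tperm b' c' * tperm a' b')%g
  | _, _, _ => 1%g
  end.

Definition alpha d : PG d := fun n => cycle_perm (d n).
(* beta_n = (1 (1+r) (1+2r)), i.e. (0 r 2r) in 0-based labels *)
Definition beta d (r : nat -> nat) : PG d :=
  fun n => cyc3 (d n) 0 (r n) (2 * r n).

Inductive inG d (r : nat -> nat) : PG d -> Prop :=
| inG_alpha : inG r (alpha d)
| inG_beta : inG r (beta d r)
| inG_one : inG r (pone d)
| inG_mul : forall x y, inG r x -> inG r y -> inG r (pmul x y)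
| inG_inv : forall x, inG r x -> inG r (pinv x).

Definition Gt d (r : nat -> nat) := {x : PG d | inG r x}.

Definition Gmul d r (x y : Gt d r) : Gt d r :=
  exist _ (pmul (proj1_sig x) (proj1_sig y)) (inG_mul (proj2_sig x) (proj2_sig y)).
Definition Ginv d r (x : Gt d r) : Gt d r :=
  exist _ (pinv (proj1_sig x)) (inG_inv (proj2_sig x)).
Definition Gone d r : Gt d r := exist _ (pone d) (inG_one d r).
Definition Gbeta d r : Gt d r := exist _ (beta d r) (inG_beta d r).

Inductive inLinf d (r : nat -> nat) : Gt d r -> Prop :=
| L_beta : inLinf (Gbeta d r)
| L_one : inLinf (Gone d r)
| L_mul : forall x y, inLinf x -> inLinf y -> inLinf (Gmul x y)
| L_inv : forall x, inLinf x -> inLinf (Ginv x)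
| L_conj : forall g x, inLinf x -> inLinf (Gmul (Gmul (Ginv g) x) g).

(* Main.v *)
Require Import Defs.
From HB Require Import structures.
From mathcomp Require Import all_boot all_order all_algebra all_fingroup.
From mathcomp Require Import all_classical all_reals all_analysis.
From mathcomp Require Import cyclic measurable_realfun.
From mathcomp Require Import zify lra.
Import Order.TTheory GRing.Theory Num.Theory.
Import numFieldNormedType.Exports.
Local Open Scope classical_set_scope.
Local Open Scope ring_scope.
Set Implicit Arguments. Unset Strict Implicit. Unset Printing Implicit Defensive.

(** Far out in the sequence, boundedly many translates of the 3-cycle beta_n have
    disjoint supports, so modulo the sum of the factors <alpha_n, beta_n> the group
    G is the lamplighter group of Z/3 over Z and L_infty is its base.  Each factor
    itself lies in L_infty: the commutator of beta and its conjugate by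
    alpha^r(N) vanishes at all coordinates above N, and its component at N has
    normal closure <alpha_N, beta_N>.

    Fix M.  For a window W of M consecutive integers let P_W be the finite group of
    the elements of L_infty whose lamps lie in W and which, at the coordinates
    n >= M, are exactly the corresponding products of 3-cycles.  Let K be the kernel
    of the map from G to the product of its first M coordinates and of the
    lamplighter group over Z/M.  Then P_W meets K trivially, P_W K contains
    L_infty, and alpha^M agrees modulo K with an element of L_infty.  Hence the law
    of (H cap P_W) K, averaged over M consecutive windows W, is a finite-index IRS.
    All but boundedly many of these windows contain the support of a given element,
    so these IRS converge to mu as M grows. *)

(** * The space of subsets and its Borel structure *)

Section subset_space.
Context {T : Type}.
Implicit Types (H : SubSp T) (g : T) (b : bool).

Lemma nbhs_SubSp_eval H g : \forall H' \near H, H' g = H g.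
Proof.
have := (@proj_continuous {classic T} (fun=> bool) g) H.
by move=> /(_ [set H g]) h; apply: h; exact: discrete_set1.
Qed.

Lemma cvg_SubSp (I : Type) (F : set_system I) (phi : I -> SubSp T) H :
  Filter F -> (forall g, \forall i \near F, phi i g = H g) -> phi @ F --> H.
Proof.
move=> FF h; apply/cvg_sup => g U [V [[W oW <-] WHg] VU].
by apply: filterS (h g) => i /= e; apply: VU; rewrite /= e.
Qed.

Lemma open_SubSp_eval g b : open [set H : SubSp T | H g = b].
Proof.
rewrite openE => H /= <-; exact: nbhs_SubSp_eval.
Qed.

Lemma closed_SubSp_eval g b : closed [set H : SubSp T | H g = b].
Proof.
rewrite -[X in closed X]setCK; apply: open_closedC.
rewrite (_ : ~` _ = [set H : SubSp T | H g = ~~ b]); first exact: open_SubSp_eval.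
by apply/seteqP; split=> H /=; case: (H g); case: b.
Qed.

Lemma measurable_open (A : set (SubSp T)) :
  open A -> measurable (A : set (BorelSp T)).
Proof. exact: sub_gen_smallest. Qed.

Lemma measurable_closed (A : set (SubSp T)) :
  closed A -> measurable (A : set (BorelSp T)).
Proof.
move=> cA; rewrite -[A]setCK; apply: measurableC; apply: measurable_open.
exact: closed_openC.
Qed.

Lemma measurable_SubSp_map (phi : SubSp T -> SubSp T) :
  continuous phi -> measurable_fun setT (phi : BorelSp T -> BorelSp T).
Proof.
move=> /continuousP cphi.
apply: (@measurability _ _ (BorelSp T) (BorelSp T) setT phi (@open (SubSp T))) => //.
move=> _ [A oA <-]; rewrite setTI; apply: measurable_open; exact: cphi.
Qed.

Lemma measurable_SubSp_fun (R : realType) (f : SubSp T -> R) :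
  continuous f -> measurable_fun setT (f : BorelSp T -> R).
Proof.
move=> /continuousP cf; apply: (measurability _ (RGenOpens.measurableE R)).
move=> _ [_ [a [b ->] <-]]; rewrite setTI; apply: measurable_open.
exact/cf/interval_open.
Qed.

Lemma bounded_SubSp_fun (R : realType) (f : SubSp T -> R) :
  continuous f -> exists2 B : R, 0 <= B & forall H, `|f H| <= B.
Proof.
move=> cf.
have cT : compact [set: SubSp T].
  have := @tychonoff {classic T} (fun=> bool) (fun=> setT) (fun _ => bool_compact).
  by rewrite (_ : [set _ | _] = setT)//; apply/seteqP.
have cfT : compact (f @` setT).
  by apply: continuous_compact => //; exact: continuous_subspaceT.
have [B [_ hB]] := compact_bounded cfT.
exists (`|B| + 1); first by rewrite addr_ge0.
move=> H; apply: hB; last by exists H.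
by rewrite (le_lt_trans (ler_norm B))// ltrDl.
Qed.

End subset_space.

(** * Averages of probability measures, and averages over windows *)

Section average.
Context d (X : measurableType d) (R : realType).
Variables (p : nat -> probability X R) (m : nat).

Definition average : set X -> \bar R := mscale (m.+1%:R^-1)%:nng (msum p m.+1).

HB.instance Definition _ := Measure.on average.

Lemma average_setT : average setT = 1%E.
Proof.
rewrite /average /= /mscale /= /msum /= (eq_bigr (fun=> 1%E)); last first.
  by move=> j _; exact: probability_setT.
by rewrite sumEFin sumr_const card_ord -EFinM mulVf.
Qed.

HB.instance Definition _ :=
  Measure_isProbability.Build _ _ _ average average_setT.

Lemma ge0_integral_average (f : X -> \bar R) :
  measurable_fun setT f -> (forall x, 0 <= f x)%E ->
  (\int[average]_x f x = m.+1%:R^-1%:E * \sum_(j < m.+1) \int[p j]_x f x)%E.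
Proof.
move=> mf f0; rewrite ge0_integral_mscale//; congr (_ * _)%E.
by rewrite ge0_integral_measure_sum.
Qed.

End average.

(** Writing the integral against the fixed measure [mu] turns convergence of averaged laws into
    convergence of integrands, to which dominated convergence applies. *)
Lemma average_pushforward d (X : measurableType d) (R : realType)
    (mu : probability X R) (phi : nat -> X -> X)
    (mphi : forall j, measurable_fun setT (phi j)) (m : nat) :
  exists nu : probability X R,
    (forall A, nu A = (m.+1%:R^-1%:E * \sum_(j < m.+1) mu (phi j @^-1` A))%E) /\
    forall f : X -> R, measurable_fun setT f -> (forall x, 0 <= f x) ->
      (\int[nu]_x (f x)%:E =
       \int[mu]_x (m.+1%:R^-1 * \sum_(j < m.+1) f (phi j x))%:E)%E.
Proof.
pose F j : {mfun X >-> X} := HB.pack (phi j) (isMeasurableFun.Build _ _ _ _ _ (mphi j)).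
exists (average (fun j => distribution mu (F j)) m); split=> // f mf f0.
have mfE : measurable_fun setT (EFin \o f) by exact/measurable_EFinP.
have mfF j : measurable_fun setT (f \o phi j) by exact: measurableT_comp.
rewrite [LHS]ge0_integral_average//.
transitivity (m.+1%:R^-1%:E * \int[mu]_x (\sum_(j < m.+1) (f (phi j x))%:E))%E.
  congr (_ * _)%E; rewrite ge0_integral_sum//; last 2 first.
  - by move=> j; exact/measurable_EFinP/mfF.
  - by move=> j x _; rewrite lee_fin.
  apply: eq_bigr => j _; rewrite ge0_integral_pushforward//.
  by move=> x _; rewrite lee_fin.
rewrite -ge0_integralZl//.
- by apply: eq_integral => x _; rewrite EFinM sumEFin.
- by apply: emeasurable_sum => j; exact/measurable_EFinP/mfF.
- by move=> x _; apply: sume_ge0 => j _; rewrite lee_fin.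
Qed.

Lemma sum_ltn_le n b : (\sum_(j < n) (j < b) <= b)%N.
Proof.
suff -> : (\sum_(j < n) (j < b) = minn n b)%N by rewrite geq_minr.
elim: n => [|n IHn]; first by rewrite big_ord0 min0n.
by rewrite big_ord_recr /= IHn; lia.
Qed.

Lemma sum_gtn_add_le m b : (\sum_(j < m.+1) (m < j + b) <= b)%N.
Proof.
rewrite (reindex_inj rev_ord_inj) /=; apply: leq_trans (@sum_ltn_le m.+1 b).
apply: leq_sum => -[j jm] _ /=.
by case: ltnP => //; case: ltnP => //; lia.
Qed.

(** At most [2 * b] indices lie near an end of the range, each with error at most [B], so their
    share of the average tends to zero. *)
Lemma cvg_average_of_window (R : realType) (x : nat -> nat -> R) (l B : R) :
  (forall m j, `|l - x m j| <= B) ->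
  (forall e, 0 < e -> exists N b, forall m j,
     (N <= m)%N -> (b <= j)%N -> (j + b <= m)%N -> `|l - x m j| <= e) ->
  (fun m => m.+1%:R^-1 * \sum_(j < m.+1) x m j) @ \oo --> l.
Proof.
move=> xB xe; apply/cvgrPdist_le => e e0.
have [N [b Nb]] := xe (e / 2) (divr_gt0 e0 (ltr0n _ 2)).
have B0 : 0 <= B by exact: le_trans (xB 0%N 0%N).
near=> m.
have m0 : 0 < m.+1%:R :> R by [].
have Nm : (N <= m)%N by near: m; exact: nbhs_infty_ge.
(* This makes the total contribution of the at most [2 * b] exceptional indices at most [e / 2]. *)
have bm : 4 * (B * b%:R) / e <= m.+1%:R.
  apply: (@le_trans _ _ m%:R); last by rewrite ler_nat.
  by near: m; exact: nbhs_infty_ger.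
have -> : l = m.+1%:R^-1 * \sum_(j < m.+1) l.
  by rewrite sumr_const card_ord -[l *+ _]mulr_natr mulrCA mulVf ?mulr1 ?pnatr_eq0.
rewrite -mulrBr -sumrB normrM ger0_norm ?invr_ge0// mulrC ler_pdivrMr//.
apply: (le_trans (ler_norm_sum _ _ _)).
apply: (@le_trans _ _ (\sum_(j < m.+1) (e / 2 + B * (((j < b) + (m < j + b))%N)%:R))).
  apply: ler_sum => j _; have [jb|jb] /= := ltnP j b.
    apply: (le_trans (xB _ _)); rewrite -[leLHS]mulr1 -[leLHS]add0r lerD//.
      by rewrite divr_ge0// ltW.
    by rewrite ler_wpM2l// ler1n.
  have [mj|mj] /= := ltnP m (j + b)%N.
    apply: (le_trans (xB _ _)); rewrite addn1 mulr1 lerDr.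
    by rewrite divr_ge0// ltW.
  by rewrite addn0 mulr0 addr0; exact: Nb.
rewrite big_split /= sumr_const card_ord -mulr_natr -mulr_sumr -natr_sum.
have : (\sum_(j < m.+1) ((j < b) + (m < j + b)) <= b + b)%N.
  by rewrite big_split /= leq_add ?sum_ltn_le ?sum_gtn_add_le.
rewrite -(ler_nat R) => /(ler_wpM2l B0) h.
have : 4 * (B * b%:R) <= e * m.+1%:R by rewrite -ler_pdivrMl// mulrC.
rewrite natrD in h; move: h; set s := (\sum_(j < _) _)%N; lra.
Unshelve. all: by end_near. Qed.

(** * Approximation by finite-index invariant random subgroups *)

Section limit.
Context {T : groupType} {R : realType}.
Implicit Types (H : SubSp T) (g x y p : T) (K P L : set T).
Local Notation cnj := (@conj_act T *%g (@monoid.inv T)).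
Local Notation subgroup := (@is_subgroup T *%g (@monoid.inv T) 1%g).

(* [P j] is the window group P_W for the [j]-th window W, [K] the kernel and [M]
   the window length; conjugation by [a] moves each window to the next one. *)
Record level L (a : T) (M : nat) K (P : nat -> set T) : Prop := Level {
  levelK1 : K 1%g;
  levelKM : forall x y, K x -> K y -> K (x * y)%g;
  levelKV : forall x, K x -> K x^-1%g;
  levelKJ : forall x g, K x -> K (g^-1 * x * g)%g;
  level_finite : exists (Q : finType) (q : T -> Q),
    forall x y, q x = q y -> K (x^-1 * y)%g;
  levelP1 : forall j, P j 1%g;
  levelPM : forall j x y, P j x -> P j y -> P j (x * y)%g;
  levelPV : forall j x, P j x -> P j x^-1%g;
  levelPL : forall j, P j `<=` L;
  levelPJ : forall j x, P j.+1 x <-> P j (a * x * a^-1)%g;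
  levelPK : forall j x, P j x -> K x -> x = 1%g;
  level_cover : forall j x, L x -> exists2 p, P j p & K (p^-1 * x)%g;
  level_period : exists2 l, L l & K (l^-1 * a ^+ M)%g
}.

(** The product set (H cap P) K, defined for every subset [H] so that it is a self-map of the whole
    Borel space. *)
Definition saturate P K H : SubSp T :=
  fun g => `[< exists p, [/\ P p, H p & K (p^-1 * g)%g] >].

Lemma saturateP P K H g :
  reflect (exists p, [/\ P p, H p & K (p^-1 * g)%g]) (saturate P K H g).
Proof. exact: asboolP. Qed.

Lemma conj_actM x y H : cnj (x * y)%g H = cnj x (cnj y H).
Proof. by apply/funext => z; rewrite /conj_act invgM !mulgA. Qed.

Lemma conj_act_continuous g : continuous (cnj g : SubSp T -> SubSp T).
Proof. by move=> H; apply: cvg_SubSp => x; exact: nbhs_SubSp_eval. Qed.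

Lemma conj_act_preimage g (A : set (BorelSp T)) :
  measurable A -> measurable (cnj g @^-1` A : set (BorelSp T)).
Proof.
move=> mA; rewrite -[X in measurable X]setTI.
exact: (measurable_SubSp_map (@conj_act_continuous g)).
Qed.

Lemma closed_subgroups : closed [set H : SubSp T | subgroup H].
Proof.
(* The implication cuts out the union of [D] with the closed set where [H c] is false. *)
have h (c : T) (D : set (SubSp T)) : closed D -> closed [set H : SubSp T | H c -> D H].
  move=> cD; rewrite (_ : [set _ | _] = [set H : SubSp T | H c = false] `|` D).
    by apply: closedU => //; exact: closed_SubSp_eval.
  apply/seteqP; split => H /=; last by case => [->|].
  by case: (H c) => h; [right; exact: h|left].
rewrite (_ : [set _ | _] = [set H : SubSp T | H 1%g = true] `&`
   ((\bigcap_(x in setT) \bigcap_(y in setT) [set H : SubSp T | H x ->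
       [set H' : SubSp T | H' y -> [set H'' : SubSp T | H'' (x * y)%g = true] H'] H]) `&`
   (\bigcap_(x in setT) [set H : SubSp T | H x -> [set H' : SubSp T | H' x^-1%g = true] H]))).
  apply: closedI; first exact: closed_SubSp_eval.
  apply: closedI.
    apply: closed_bigI => x _; apply: closed_bigI => y _.
    by apply: (h); apply: (h); exact: closed_SubSp_eval.
  by apply: closed_bigI => x _; apply: (h); exact: closed_SubSp_eval.
apply/seteqP; split => H /=.
  by move=> [h1 [hM hV]]; split => //; split => [x _ y _|x _] /=; [exact: hM|exact: hV].
move=> [h1 [hM hV]]; split => //; split => [x y|x].
  exact: (hM x I y I).
exact: (hV x I).
Qed.

Lemma closed_sub_subgroups L : closed [set H : SubSp T | subgroup H /\ forall g, H g -> L g].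
Proof.
rewrite (_ : [set _ | _] = [set H : SubSp T | subgroup H] `&`
   \bigcap_(g in ~` L) [set H : SubSp T | H g = false]).
  apply: closedI; first exact: closed_subgroups.
  by apply: closed_bigI => x _; exact: closed_SubSp_eval.
apply/seteqP; split => H /= [hH hL]; split => // g.
  by move=> nLg; apply/negbTE/negP => /hL.
by move=> Hg; apply: contrapT => /hL /=; rewrite Hg.
Qed.

(** * Saturation at one level: continuity and equivariance *)

Section one_level.
Variables (L : set T) (a : T) (M : nat) (K : set T) (P : nat -> set T).
Hypothesis lv : level L a M K P.

(** Since [P j] meets [K] trivially, [q] is injective on it, so [P j] is finite. *)
Lemma level_enum : exists (Q : finType) (e : nat -> Q -> T),
  forall j x, P j x <-> exists i, e j i = x.
Proof.
have [Q [q qK]] := level_finite lv.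
(* A class that misses [P j] receives the default 1, which belongs to [P j] anyway. *)
exists Q, (fun j i => xget 1%g [set x | P j x /\ q x = i]) => j x; split.
  move=> Px; exists (q x).
  have [] := xgetPex 1%g (ex_intro [set y | P j y /\ q y = q x] x (conj Px erefl)).
  set y := xget _ _ => Py /qK Kyx.
  have /(levelPK lv) := levelPM lv (levelPV lv Py) Px.
  by move=> /(_ Kyx)/(congr1 (mul y)); rewrite mulVKg mulg1.
by move=> [i <-]; case: xgetP => [_ -> []//|_]; exact: (levelP1 lv).
Qed.

(** Only the values of [H] on the finite set [P j] matter. *)
Lemma saturate_continuous j : continuous (saturate (P j) K).
Proof.
have [Q [e eP]] := level_enum.
move=> H; apply: cvg_SubSp => g.
have : \forall H' \near H, forall i, H' (e j i) = H (e j i).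
  apply: (@filter_forall (SubSp T) Q (fun i => [set H' | H' (e j i) = H (e j i)]) (nbhs H)).
  by move=> i; exact: nbhs_SubSp_eval.
apply: filterS => H' eH; apply/asbool_equiv_eq; split => -[p [Pp Hp Kp]];
  exists p; split => //; have [i ei] := (eP j p).1 Pp; move: Hp.
  by rewrite -ei eH.
by rewrite -ei eH.
Qed.

(** [cnj a] sends H to a H a^-1, which carries [P j.+1] onto [P j] and preserves the normal subgroup
    [K]. *)
Lemma conj_saturate j H : cnj a (saturate (P j.+1) K H) = saturate (P j) K (cnj a H).
Proof.
apply/funext => g; apply/asbool_equiv_eq; split => -[p [Pp Hp Kp]].
  exists (a * p * a^-1)%g; split; first exact/(levelPJ lv).
    by rewrite /conj_act !mulgA mulVg mul1g mulgVK.
  have := levelKJ lv (a^-1)%g Kp.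
  by rewrite invgK !mulgA !invgM invgK !mulgA mulgK.
exists (a^-1 * p * a)%g; split => //.
  by apply/(levelPJ lv); rewrite !mulgA mulgV mul1g mulgK.
have := levelKJ lv a Kp.
by rewrite !invgM invgK !mulgA mulgK.
Qed.

(** The saturation is a union of cosets of [K], and conjugation by [k] is trivial modulo [K]. *)
Lemma conj_saturate_ker j k H : K k -> cnj k (saturate (P j) K H) = saturate (P j) K H.
Proof.
move=> Kk; apply/funext => x; apply/asbool_equiv_eq; split => -[q [Pq Hq Kq]];
  exists q; split => //.
  have := levelKM lv (levelKJ lv q Kk) (levelKM lv Kq (levelKV lv Kk)).
  by rewrite !mulgA !mulgK.
have := levelKM lv (levelKJ lv q (levelKV lv Kk)) (levelKM lv Kq Kk).
by rewrite !mulgA !mulgK.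
Qed.

Lemma conj_saturate_window j p H : P j p ->
  cnj p (saturate (P j) K H) = saturate (P j) K (cnj p H).
Proof.
move=> Pp; apply/funext => x; apply/asbool_equiv_eq; split => -[q [Pq Hq Kq]].
  exists (p * q * p^-1)%g; split.
  - by apply: (levelPM lv) => //; [exact: (levelPM lv)|exact: (levelPV lv)].
  - by rewrite /conj_act !mulgA mulVg mul1g mulgVK.
  have := levelKJ lv (p^-1)%g Kq.
  by rewrite !invgM !invgK !mulgA mulgK.
exists (p^-1 * q * p)%g; split => //.
  by apply: (levelPM lv) => //; apply: (levelPM lv) => //; exact: (levelPV lv).
have := levelKJ lv p Kq.
by rewrite !invgM invgK !mulgA mulgK.
Qed.

(** Modulo [K], such a [g] is congruent to some [p] in [P j]; [K] acts trivially on saturations and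
    [p] normalises [P j]. *)
Lemma conj_saturate_inner j g : (exists2 l, L l & K (l^-1 * g)%g) ->
  exists p, forall H, cnj g (saturate (P j) K H) = saturate (P j) K (cnj p H).
Proof.
move=> [l Ll Klg].
have [p Pp Kpl] := level_cover lv j Ll.
have Kpg : K (p^-1 * g)%g by have := levelKM lv Kpl Klg; rewrite -mulgA mulVKg.
exists p => H; rewrite -(conj_saturate_window _ Pp) -[g in LHS](mulVKg p).
by rewrite conj_actM conj_saturate_ker.
Qed.

Lemma saturate_subgroup j H : subgroup H -> subgroup (saturate (P j) K H).
Proof.
move=> [H1 [HM HV]]; split; [|split].
- apply/saturateP; exists 1%g; split => //; first exact: (levelP1 lv).
  by rewrite invg1 mul1g; exact: (levelK1 lv).
- move=> x y /saturateP[p [Pp Hp Kp]] /saturateP[q [Pq Hq Kq]].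
  apply/saturateP; exists (p * q)%g; split; [exact: (levelPM lv)|exact: HM|].
  have := levelKM lv (levelKJ lv q Kp) Kq.
  by rewrite invgM -!mulgA mulVKg.
- move=> x /saturateP[p [Pp Hp Kp]].
  apply/saturateP; exists (p^-1)%g; split; [exact: (levelPV lv)|exact: HV|].
  have := levelKJ lv (p^-1)%g (levelKV lv Kp).
  by rewrite !invgM !invgK !mulgA mulgK.
Qed.

Lemma saturate_finite_index j H : H 1%g ->
  finite_index *%g (@monoid.inv T) (saturate (P j) K H).
Proof.
move=> H1; have [Q [q qK]] := level_finite lv.
(* The saturation contains [K], so one representative for each nonempty fibre of [q] meets all its
   cosets. *)
pose rep (c : Q) := xget 1%g [set y | q y = c].
exists #|Q|, (fun i => if insub i is Some o then rep (enum_val (o : 'I_#|Q|)) else 1%g).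
move=> g; exists (enum_rank (q g)); split => //.
rewrite valK enum_rankK; apply/saturateP; exists 1%g; split => //.
  exact: (levelP1 lv).
by rewrite invg1 mul1g; apply: qK; apply: (@xgetPex _ 1%g [set y | q y = q g]); exists g.
Qed.

Lemma measurable_saturate j :
  measurable_fun setT (saturate (P j) K : BorelSp T -> BorelSp T).
Proof. exact: (measurable_SubSp_map (@saturate_continuous j)). Qed.

Lemma saturate_preimage j (A : set (BorelSp T)) :
  measurable A -> measurable (saturate (P j) K @^-1` A : set (BorelSp T)).
Proof.
by move=> mA; rewrite -[X in measurable X]setTI; exact: measurable_saturate.
Qed.

(** * Laws of the saturations *)

Section level_measure.
Variable mu : probability (BorelSp T) R.
Hypothesis mu_IRS : IRS *%g (@monoid.inv T) 1%g mu.

Lemma saturate_law_inner j g (A : set (BorelSp T)) :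
  (exists2 l, L l & K (l^-1 * g)%g) -> measurable A ->
  mu (saturate (P j) K @^-1` (cnj g @^-1` A)) = mu (saturate (P j) K @^-1` A).
Proof.
move=> /(conj_saturate_inner j)[p hp] mA.
rewrite -[RHS](mu_IRS.2 p); last exact: saturate_preimage.
by congr (mu _); apply/seteqP; split => H /=; rewrite hp.
Qed.

Lemma saturate_law_shift j n (A : set (BorelSp T)) : measurable A ->
  mu (saturate (P (j + n)) K @^-1` (cnj (a ^+ n)%g @^-1` A)) =
  mu (saturate (P j) K @^-1` A).
Proof.
elim: n A => [|n IHn] A mA.
  rewrite addn0 expg0; congr (mu _); apply/seteqP.
  by split => H /=; rewrite /conj_act; under eq_fun do rewrite invg1 mul1g mulg1.
rewrite -(IHn A mA) -[RHS](mu_IRS.2 a); last first.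
  by apply: saturate_preimage; exact: conj_act_preimage.
congr (mu _); apply/seteqP; split => H /=;
  by rewrite addnS expgSr conj_actM conj_saturate.
Qed.

(** a^M is congruent modulo [K] to an element of [L], so passing through [M] windows returns to the
    first law. *)
Lemma saturate_law_period (A : set (BorelSp T)) : measurable A ->
  mu (saturate (P M) K @^-1` A) = mu (saturate (P 0) K @^-1` A).
Proof.
move=> mA; rewrite -(saturate_law_shift 0 M)// add0n saturate_law_inner//.
exact: (level_period lv).
Qed.

(** Conjugation by [a] permutes the [M] laws cyclically; [saturate_law_period] closes the cycle. *)
Lemma saturate_law_sum_conj (A : set (BorelSp T)) : measurable A ->
  (\sum_(j < M) mu (saturate (P j) K @^-1` (cnj a @^-1` A)) =
   \sum_(j < M) mu (saturate (P j) K @^-1` A))%E.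
Proof.
move=> mA; case eM: M => [|m]; first by rewrite !big_ord0.
rewrite big_ord_recl [RHS]big_ord_recr /= addeC; congr (_ + _)%E.
  by apply: eq_bigr => j _; rewrite /= -(saturate_law_shift j 1 mA) expg1 addn1.
rewrite -saturate_law_period; last exact: conj_act_preimage.
by rewrite eM -(saturate_law_shift m 1 mA) expg1 addn1.
Qed.

(** Sorting [H] by its trace on the finite set [P j] gives finitely many cylinders, and the
    saturation is constant on each. For a trace of no subgroup, [S j b] need not be a subgroup,
    hence the restriction to nonzero weights. *)
Lemma saturate_law_atomic : exists (B : finType) (S : nat -> B -> SubSp T)
    (c : nat -> B -> R),
  (forall j b, 0 <= c j b) /\
  (forall j b, c j b != 0 ->
     subgroup (S j b) /\ finite_index *%g (@monoid.inv T) (S j b)) /\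
  forall j (A : set (BorelSp T)), measurable A ->
    mu (saturate (P j) K @^-1` A) = (\sum_b (c j b * \1_A (S j b : BorelSp T))%:E)%E.
Proof.
have [Q [e eP]] := level_enum.
pose S j (b : {ffun Q -> bool}) : SubSp T :=
  fun g => `[< exists i, b i /\ K ((e j i)^-1 * g)%g >].
pose cyl j (b : {ffun Q -> bool}) : set (BorelSp T) :=
  [set H | forall i, H (e j i) = b i].
have satE j b H : cyl j b H -> saturate (P j) K H = S j b.
  move=> Hb; apply/funext => g; apply/asbool_equiv_eq; split.
    by move=> [p [/eP[i <-] Hi Ki]]; exists i; rewrite -Hb.
  by move=> [i [bi Ki]]; exists (e j i); split => //; [apply/eP; exists i|rewrite Hb].
have mcyl j b : measurable (cyl j b).
  rewrite (_ : cyl j b = \bigcap_(i in setT) [set H : BorelSp T | H (e j i) = b i]).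
    apply: measurable_closed; apply: closed_bigI => i _; exact: closed_SubSp_eval.
  by apply/seteqP; split => H /= h i; [move=> _|]; exact: h.
exists {ffun Q -> bool}, S, (fun j b => fine (mu (cyl j b))); split; [|split].
- by move=> j b; rewrite fine_ge0.
- move=> j b c0.
  have [[H [Hb Hs]]|noH] := pselect (exists H, cyl j b H /\ subgroup H).
    rewrite -(satE _ _ _ Hb); split; first exact: saturate_subgroup.
    by apply: saturate_finite_index; case: Hs.
  (* A cylinder without subgroups lies in the null set of non-subgroups. *)
  exfalso; move/eqP: c0; apply; suff -> : mu (cyl j b) = 0%E by [].
  apply/eqP; rewrite eq_le measure_ge0 andbT.
  have mS : measurable [set H : BorelSp T | subgroup H].
    exact: measurable_closed closed_subgroups.
  have <- : mu (~` [set H : BorelSp T | subgroup H]) = 0%E.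
    by rewrite probability_setC// mu_IRS.1 subee.
  apply: le_measure; rewrite ?inE//; first exact: measurableC.
  by move=> H Hb Hs; apply: noH; exists H.
move=> j A mA.
set B := saturate (P j) K @^-1` A.
have mB : measurable (B : set (BorelSp T)) by exact: saturate_preimage.
have -> : B = \bigcup_(b in setT) (B `&` cyl j b).
  apply/seteqP; split => H /= => [BH|[b _ []//]].
  by exists [ffun i => H (e j i)] => //; split => // i; rewrite ffunE.
rewrite measure_fin_bigcup; last 3 first.
- exact: finite_finset.
- apply/trivIsetP => b b' _ _ /eqP bb'; apply/seteqP; split => // H /= [[_ h1] [_ h2]].
  by apply: bb'; apply/ffunP => i; rewrite -h1 -h2.
- by move=> b _; exact: measurableI.
rewrite (fsbigE (index_enum _)) ?index_enum_uniq//; last first.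
  by move=> b _; rewrite mem_index_enum.
rewrite big_mkcond /=; apply: eq_bigr => b _; rewrite in_setT indicE.
have [Ab|nAb] := boolP (_ \in A).
  rewrite mulr1 fineK ?fin_num_measure//; congr (mu _).
  apply/seteqP; split => H /= => [[]//|Hb]; split => //.
  by rewrite /B /= (satE _ _ _ Hb); exact: set_mem.
rewrite mulr0 (_ : _ `&` _ = set0) ?measure0//.
apply/seteqP; split => // H /= [BH Hb]; move/negP: nAb; apply.
by apply/mem_set; rewrite -(satE _ _ _ Hb).
Qed.

End level_measure.
End one_level.

(** Pads a finite sum to the series in [finite_index_IRS]. There every listed set must be a
    finite-index subgroup, so entries of weight zero are replaced by the whole group. *)
Lemma finite_index_IRS_finite (nu : probability (BorelSp T) R) (I : finType)
    (c : I -> R) (S : I -> SubSp T) :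
  IRS *%g (@monoid.inv T) 1%g nu -> (forall i, 0 <= c i) ->
  (forall i, c i != 0 -> subgroup (S i) /\ finite_index *%g (@monoid.inv T) (S i)) ->
  (forall A : set (BorelSp T), measurable A ->
     nu A = (\sum_i (c i * \1_A (S i : BorelSp T))%:E)%E) ->
  finite_index_IRS *%g (@monoid.inv T) 1%g nu.
Proof.
move=> nuI c0 cS nuE; split=> //.
pose S' i : T -> bool := if c i == 0 then fun=> true else S i.
exists (fun n => if insub n is Some o then c (enum_val (o : 'I_#|I|)) else 0).
exists (fun n => if insub n is Some o then S' (enum_val (o : 'I_#|I|)) else fun=> true).
split; [|split].
- by move=> n; case: insubP.
- have fT : subgroup (fun=> true) /\ finite_index *%g (@monoid.inv T) (fun=> true).
    by split => //; exists 1%N, (fun=> 1%g) => g; exists 0%N.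
  move=> n; case: insubP => // o _ _; rewrite /S'.
  by case: eqP => // /eqP /cS.
move=> A mA; rewrite nuE// (nneseries_split 0 #|I|); last first.
  by move=> k _; rewrite -EFinM lee_fin mulr_ge0// ; case: insubP.
rewrite eseries0 ?adde0; last first.
  by move=> i; rewrite add0n => Ii _; rewrite insubN -?leqNgt// mul0e.
rewrite add0n big_mkord (reindex (@enum_val I I)); last first.
  by apply: onW_bij; exact: enum_val_bij.
rewrite big_mkcond/= [RHS]big_mkcond/=; apply: eq_bigr => o _.
rewrite valK -EFinM /S'; case: eqP => [->|//]; by rewrite !mul0r.
Qed.

(** [nu] averages the laws of the saturations over [m.+1] windows. Elements of [L] preserve each
    law, [a] permutes the laws, and together they generate the group. *)
Lemma level_measure (mu : probability (BorelSp T) R) L a m K (P : nat -> set T) :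
  (forall S : set T, S a -> L `<=` S ->
     (forall x y, S x -> S y -> S (x * y)%g) -> (forall x, S x -> S x^-1%g) ->
     forall x, S x) ->
  level L a m.+1 K P -> IRS *%g (@monoid.inv T) 1%g mu ->
  exists2 nu : probability (BorelSp T) R,
    finite_index_IRS *%g (@monoid.inv T) 1%g nu &
    forall f : SubSp T -> R, continuous f -> (forall H, 0 <= f H) ->
      (\int[nu]_H Efun f H =
       \int[mu]_H (m.+1%:R^-1 * \sum_(j < m.+1) f (saturate (P j) K H))%:E)%E.
Proof.
move=> gen lv muI.
have msat j := measurable_saturate lv j.
have [nu [nuE nuf]] := average_pushforward mu msat m.
exists nu; last by move=> f cf f0; apply: nuf => //; exact: measurable_SubSp_fun.
have [B [S [c [c0 [cS cE]]]]] := saturate_law_atomic lv muI.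
have nuI : IRS *%g (@monoid.inv T) 1%g nu.
  split.
    have mS : measurable [set H : BorelSp T | subgroup H].
      exact: measurable_closed closed_subgroups.
    rewrite nuE (eq_bigr (fun=> 1%E)).
      by rewrite sumEFin sumr_const card_ord -EFinM mulVf.
    move=> j _; apply/eqP; rewrite eq_le probability_le1 /=; last first.
      by rewrite -[X in measurable X]setTI; exact: msat.
    rewrite -muI.1; apply: le_measure; rewrite ?inE//.
      by rewrite -[X in measurable X]setTI; exact: msat.
    by move=> H /= HH; exact: (saturate_subgroup lv).
  (* [gen] is applied to the set of elements whose conjugation preserves [nu]. *)
  apply: gen.
  - by move=> A mA; rewrite !nuE; congr (_ * _)%E; exact: (saturate_law_sum_conj lv muI).
  - move=> l Ll A mA; rewrite !nuE; congr (_ * _)%E; apply: eq_bigr => j _.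
    apply: (saturate_law_inner lv muI) => //.
    by exists l => //; rewrite mulVg; exact: (levelK1 lv).
  - move=> x y nx ny A mA.
    rewrite -(nx A mA) -(ny (cnj x @^-1` A)); last exact: conj_act_preimage.
    by congr (nu _); apply/seteqP; split => H /=; rewrite conj_actM.
  - move=> x nx A mA.
    rewrite -(nx (cnj x^-1%g @^-1` A)); last exact: conj_act_preimage.
    congr (nu _); apply/seteqP; split => H /=; rewrite -conj_actM mulVg;
    rewrite /conj_act; under eq_fun do rewrite invg1 mul1g mulg1; done.
apply: (@finite_index_IRS_finite nu ('I_m.+1 * B)%type
  (fun i => m.+1%:R^-1 * c i.1 i.2) (fun i => S i.1 i.2)) => //.
- by move=> i; rewrite mulr_ge0.
- by move=> [j b] /=; rewrite mulf_eq0 negb_or => /andP[_]; exact: cS.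
move=> A mA; rewrite nuE; under eq_bigr do rewrite cE//.
rewrite pair_big /= sumEFin [RHS]sumEFin -EFinM mulr_sumr; congr (_%:E).
by apply: eq_bigr => -[j b] _ /=; rewrite mulrA.
Qed.

(** * Convergence of the averaged laws *)

Section cosofic_limit.
Variables (L : set T) (a : T) (K : nat -> set T) (P : nat -> nat -> set T).
Hypothesis genT : forall S : set T, S a -> L `<=` S ->
  (forall x y, S x -> S y -> S (x * y)%g) -> (forall x, S x -> S x^-1%g) ->
  forall x, S x.
Hypothesis lv : forall m, level L a m.+1 (K m) (P m).
Hypothesis window_exhaust : forall x, L x -> exists b, forall m j,
  (b <= j)%N -> (j + b <= m)%N -> P m j x.
Hypothesis outside : forall x, ~ L x -> exists N, forall m j p,
  (N <= m)%N -> P m j p -> ~ K m (p^-1 * x)%g.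

(** Once [g] in [L] lies in the window group, it belongs to (H cap P) K exactly when it belongs to
    [H], because P cap K = 1. A [g] outside [L] eventually avoids P K, so the saturations converge
    pointwise to [H]. *)
Lemma cvg_saturate_window (H : SubSp T) (f : SubSp T -> R) :
  subgroup H -> (forall g, H g -> L g) -> continuous f ->
  forall e, 0 < e -> exists N b, forall m j,
    (N <= m)%N -> (b <= j)%N -> (j + b <= m)%N ->
    `|f H - f (saturate (P m j) (K m) H)| <= e.
Proof.
move=> [H1 [HM HV]] HL cf e e0.
(* These sets generate the filter of pairs with [m] large and [j] far from both ends of the
   range. *)
pose D (i : nat * nat) : set (nat * nat) :=
  [set mj | [/\ (i.1 <= mj.1)%N, (i.2 <= mj.2)%N & (mj.2 + i.2 <= mj.1)%N]].
pose F : set_system (nat * nat) := filter_from setT D.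
have FF : Filter F.
  apply: filter_from_filter; first by exists (0%N, 0%N).
  move=> i i' _ _; exists (maxn i.1 i'.1, maxn i.2 i'.2) => // -[m j] /= [h1 h2 h3].
  by rewrite /= in h1 h2 h3; split; split => /=; lia.
have : (fun mj : nat * nat => saturate (P mj.1 mj.2) (K mj.1) H) @ F --> H.
  apply: cvg_SubSp => g; have [Lg|nLg] := pselect (L g).
    have [b hb] := window_exhaust Lg.
    exists (0%N, b) => // -[m j] /= [_ bj jb].
    have Pg := hb m j bj jb; apply/idP/idP.
      move=> /saturateP[p [Pp Hp Kp]].
      have := levelPK (lv m) (levelPM (lv m) (levelPV (lv m) Pp) Pg) Kp.
      by move/(congr1 (mul p)); rewrite mulVKg mulg1 => ->.
    move=> Hg; apply/saturateP; exists g; split => //.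
    by rewrite mulVg; exact: (levelK1 (lv m)).
  have [N hN] := outside nLg.
  exists (N, 0%N) => // -[m j] /= [Nm _ _].
  have -> : H g = false by apply/negbTE/negP => /HL.
  by apply/negbTE/negP => /saturateP[p [Pp Hp Kp]]; exact: (hN m j p).
move=> /(cvg_comp _ _) /(_ (cf H)) /cvgrPdist_le /(_ e e0) [[N b] _ hD].
by exists N, b => m j Nm bj jb; apply: (hD (m, j)).
Qed.

Theorem cosofic_of_levels (mu : probability (BorelSp T) R) :
  IRS *%g (@monoid.inv T) 1%g mu ->
  mu [set H | subgroup H /\ forall g, H g -> L g] = 1%E ->
  cosofic *%g (@monoid.inv T) 1%g mu.
Proof.
move=> muI muL.
have /choice[nu hnu] m : exists nu : probability (BorelSp T) R,
    finite_index_IRS *%g (@monoid.inv T) 1%g nu /\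
    forall f : SubSp T -> R, continuous f -> (forall H, 0 <= f H) ->
      (\int[nu]_H Efun f H = \int[mu]_H
         (m.+1%:R^-1 * \sum_(j < m.+1) f (saturate (P m j) (K m) H))%:E)%E.
  by have [nu ? ?] := level_measure genT (lv m) muI; exists nu.
exists nu; split => [m|f cf]; first exact: (hnu m).1.
have mLS : measurable [set H : BorelSp T | subgroup H /\ forall g, H g -> L g].
  exact: measurable_closed (@closed_sub_subgroups L).
have muC : mu (~` [set H : BorelSp T | subgroup H /\ forall g, H g -> L g]) = 0%E.
  by rewrite probability_setC// muL subee.
(* The integral formula for [nu] is stated for nonnegative functions; a general [f] is shifted by
   its bound afterwards. *)
have posf (h : SubSp T -> R) : continuous h -> (forall H, 0 <= h H) ->
    (fun k => \int[nu k]_x Efun h x)%E @ \oo --> (\int[mu]_x Efun h x)%E.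
  move=> ch h0; have [B B0 hB] := bounded_SubSp_fun ch.
  have mh := measurable_SubSp_fun ch.
  under eq_fun do rewrite (hnu _).2//.
  have msum m : measurable_fun setT (fun H : BorelSp T =>
      m.+1%:R^-1 * \sum_(j < m.+1) h (saturate (P m j) (K m) H)).
    apply: measurable_funM => //; apply: measurable_sum => j.
    by apply: (measurableT_comp mh); exact: (measurable_saturate (lv m)).
  have [] // := @dominated_convergence _ (BorelSp T) R mu setT measurableT
    (fun m H => (m.+1%:R^-1 * \sum_(j < m.+1) h (saturate (P m j) (K m) H))%:E)
    (Efun h) (fun=> B%:E).
  - by move=> m; apply/measurable_EFinP; exact: msum.
  - by apply/measurable_EFinP; exact: mh.
  (* Pointwise convergence holds on the subgroups contained in [L], a set of full measure. *)
  - exists (~` [set H : BorelSp T | subgroup H /\ forall g, H g -> L g]); split.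
    + exact: measurableC.
    + exact: muC.
    move=> H /= nH [Hs HL]; apply: nH => _.
    apply: cvg_EFin; first by near=> m.
    apply: (@cvg_average_of_window _
      (fun m j => h (saturate (P m j) (K m) H)) _ (B + B)).
      by move=> m j; rewrite (le_trans (ler_normB _ _))// lerD.
    exact: cvg_saturate_window.
  - exact: finite_measure_integrable_cst.
  - apply: aeW => H m _ /=; rewrite lee_fin ger0_norm; last first.
      by rewrite mulr_ge0// sumr_ge0.
    rewrite mulrC ler_pdivrMr//; apply: (@le_trans _ _ (\sum_(j < m.+1) B)).
      by apply: ler_sum => j _; rewrite (le_trans (ler_norm _)).
    by rewrite sumr_const card_ord mulr_natr.
have [B B0 hB] := bounded_SubSp_fun cf.
have intE (p : probability (BorelSp T) R) :
    (\int[p]_x Efun f x = \int[p]_x Efun (fun H => (f H + B)%R) x - B%:E)%E.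
  have iB : p.-integrable setT (EFin \o cst B) by exact: finite_measure_integrable_cst.
  have if_ : p.-integrable setT (Efun f).
    apply: measurable_bounded_integrable => //.
    - by have := ltry (1 : R); rewrite -(probability_setT p).
    - exact: measurable_SubSp_fun.
    - by exists B; split=> [|x Bx H _]; [exact: num_real|exact: le_trans (ltW Bx)].
  under [X in (_ = X - _)%E]eq_integral do rewrite /Efun EFinD.
  rewrite [X in (_ = X - _)%E](integralD measurableT if_ iB) /=.
  have iBE : (\int[p]__ B%:E = B%:E)%E.
    rewrite -[LHS]/(\int[p]_x cst B%:E x)%E integral_cst//.
    rewrite [X in (_ * X)%E](_ : _ = 1%E) ?mule1//.
    exact: probability_setT.
  by rewrite iBE addeK.
rewrite intE; under eq_fun do rewrite intE.
apply: cvgeB; last exact: cvg_cst.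
  by rewrite fin_num_adde_defl.
apply: posf => [|H]; last first.
  by rewrite -lerBlDr sub0r; have := hB H; rewrite ler_norml => /andP[].
by move=> H; apply: cvgD; [exact: cf|exact: cvg_cst].
Unshelve. all: by end_near.
Qed.

End cosofic_limit.
End limit.
(** * The finite factors *)

Section cyclic_points.
Variables (d : nat) (d_gt0 : (0 < d)%N).

Lemma pt_subproof (x : int) : (`|(x %% d)%Z| < d)%N.
Proof. by have := ltz_pmod x (d := d%:Z) d_gt0; have := modz_ge0 x (d := d%:Z); lia. Qed.

(** Integer labels modulo [d] allow translation in both directions without cases. *)
Definition pt (x : int) : 'I_d := Ordinal (pt_subproof x).

Lemma pt_eq x y : (pt x == pt y) = (d %| x - y)%Z.
Proof.
rewrite -eqz_mod_dvd -val_eqE /=.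
have := modz_ge0 x (d := d%:Z); have := modz_ge0 y (d := d%:Z).
by lia.
Qed.

Lemma pt_val (z : 'I_d) : pt z%:Z = z.
Proof. by apply: val_inj; rewrite /= modz_small //; have := ltn_ord z; lia. Qed.

Lemma pt_addK x : pt (x + d%:Z) = pt x.
Proof. by apply/eqP; rewrite pt_eq addrAC subrr add0r. Qed.

Lemma cycle_perm_pt x : cycle_perm d (pt x) = pt (x + 1).
Proof.
rewrite permE; apply: val_inj => /=.
have hx : `|(x %% d)%Z|%:Z = (x %% d)%Z by rewrite gez0_abs// modz_ge0//; lia.
by rewrite -modzDml -{2}hx -PoszD modz_nat addn1.
Qed.

Lemma cycle_permX_pt k x : (cycle_perm d ^+ k)%g (pt x) = pt (x + k%:Z).
Proof.
elim: k x => [|k IHk] x; first by rewrite expg0 perm1 addr0.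
by rewrite expgS permM cycle_perm_pt IHk -addrA; congr (pt (_ + _)); lia.
Qed.

Lemma cycle_permV_pt x : (cycle_perm d)^-1%g (pt x) = pt (x - 1).
Proof. by apply: (@perm_inj _ (cycle_perm d)); rewrite permKV cycle_perm_pt subrK. Qed.

Variable r : nat.
Hypotheses (r_gt0 : (0 < r)%N) (r3_le : (3 * r <= d)%N).

(** The labels differ by less than r + 2r <= d, so congruence modulo [d] is equality; then |y - y'|
    < r forces c = c'. *)
Lemma pt_inj (y y' : int) (c c' : 'I_3) : `|y - y'| < r%:Z ->
  pt (y + c%:Z * r%:Z) = pt (y' + c'%:Z * r%:Z) -> y = y' /\ c = c'.
Proof.
move=> yy' /eqP; rewrite pt_eq => /dvdzP[q qE].
have hX : `|(y - y') + (c%:Z - c'%:Z) * r%:Z| < d%:Z.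
  by case: c c' {qE} => [[|[|[|]]] ?] // [[|[|[|]]] ?] //=; lia.
have q0 : q = 0.
  have qE' : q * d%:Z = (y - y') + (c%:Z - c'%:Z) * r%:Z by rewrite -qE; lia.
  rewrite -qE' in hX.
  have [//|q0] := eqVneq q 0; exfalso; move: hX; rewrite normrM => hX.
  have : 1 * `|d%:Z| <= `|q| * `|d%:Z| :> int by apply: ler_wpM2r => //; lia.
  lia.
move: qE; rewrite q0 mul0r => qE.
case: c c' qE {hX} => [[|[|[|]]] c2] // [[|[|[|]]] c2'] //= qE;
  split; try lia; apply: val_inj => //=; lia.
Qed.

Lemma cyc3E : cyc3 d 0 r (2 * r) =
  (tperm (pt r%:Z) (pt (2 * r%:Z)) * tperm (pt 0) (pt r%:Z))%g.
Proof.
have h k : (k < d)%N -> (insub k : option 'I_d) = Some (pt k%:Z).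
  move=> kd; rewrite insubT; congr Some; apply: val_inj => /=.
  by rewrite modz_small//; lia.
by rewrite /cyc3 !h//; lia.
Qed.

Lemma cyc3_pt0 (c : 'I_3) :
  cyc3 d 0 r (2 * r) (pt (c%:Z * r%:Z)) = pt ((ordS c)%:Z * r%:Z).
Proof.
have ne (k k' : 'I_3) : k != k' -> pt (k%:Z * r%:Z) != pt (k'%:Z * r%:Z).
  move=> kk'; apply/eqP => e; move/eqP: kk'; apply.
  by apply: (proj2 (@pt_inj 0 0 k k' _ _)); rewrite ?add0r// subrr normr0 ltz_nat.
pose o i (i3 : (i < 3)%N) := Ordinal i3.
have n01 : pt 0 != pt r%:Z.
  by have := ne (@o 0 isT) (@o 1 isT) isT; rewrite /= mul0r mul1r.
have n02 : pt 0 != pt (2 * r%:Z).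
  by have := ne (@o 0 isT) (@o 2 isT) isT; rewrite /= mul0r.
have n12 : pt r%:Z != pt (2 * r%:Z).
  by have := ne (@o 1 isT) (@o 2 isT) isT; rewrite /= mul1r.
rewrite cyc3E permM.
case: c => [[|[|[|]]] ?] //=; rewrite ?mul0r ?mul1r.
- by rewrite (@tpermD _ _ _ (pt 0)) ?tpermL// eq_sym.
- by rewrite tpermL tpermD.
- by rewrite tpermR tpermR.
Qed.

Lemma cyc3_fix z : (forall c : 'I_3, z != pt (c%:Z * r%:Z)) ->
  cyc3 d 0 r (2 * r) z = z.
Proof.
move=> h; rewrite cyc3E permM.
have h0 : z != pt 0 by have := h (@Ordinal 3 0 isT); rewrite /= mul0r.
have h1 : z != pt r%:Z by have := h (@Ordinal 3 1 isT); rewrite /= mul1r.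
have h2 : z != pt (2 * r%:Z) by exact: h (@Ordinal 3 2 isT).
by rewrite !tpermD // eq_sym.
Qed.

End cyclic_points.

(** * Subgroups normalised by a transitive permutation of prime degree *)

Section normal_subgroups_of_prime_degree.
Variables (d : nat) (A : {group 'S_d}).

(** Powers of [a] permute the orbits of [A] transitively, so these have equal size, a divisor of the
    prime [d]. Size 1 would make [A] trivial, and size [d] divides the order of [A]. *)
Lemma dvdn_prime_degree (a : 'S_d) : prime d ->
  (forall x y, exists k, (a ^+ k)%g x = y) -> a \in 'N(A)%g -> (A :!=: 1)%g ->
  (d %| #|A|)%N.
Proof.
move=> d_pr a_trans aN A1.
have x0 : 'I_d := Ordinal (prime_gt0 d_pr).
have orbE x : #|orbit 'P A x| = #|orbit 'P A x0|.
  have [k <-] := a_trans x0 x.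
  have kN : (a ^+ k \in 'N(A))%g by exact: groupX.
  rewrite -[RHS](card_imset _ (@perm_inj _ (a ^+ k)%g)); apply: eq_card => y.
  rewrite -(permKV (a ^+ k)%g y) mem_imset; last exact: perm_inj.
  have := @orbit_conjsg_in _ _ _ 'P%act A (a ^+ k)%g x0 ((a ^+ k)^-1%g y)
    (finset.subsetT A) (finset.in_setT _).
  by rewrite (normP kN).
have : (#|orbit 'P A x0| %| d)%N.
  have aT : [acts A, on @finset.setTfor 'I_d | 'P].
    by apply/actsP => s _ z; rewrite !finset.in_setT.
  rewrite -[X in (_ %| X)%N](card_ord d) -cardsT -(acts_sum_card_orbit aT).
  by apply: dvdn_sum => _ /imsetP[x _ ->]; rewrite orbE.
case/primeP: d_pr => _ dP /dP /orP[/eqP o1|/eqP od]; last first.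
  by have := dvdn_orbit 'P A x0; rewrite od.
case/trivgPn: A1 => s sA s1; exfalso; move/eqP: s1; apply; apply/permP => x.
rewrite perm1; apply/eqP; rewrite -finset.in_set1 -(card_orbit1 (etrans (orbE x) o1)).
exact: mem_orbit.
Qed.

Lemma dvdn_square_fact p : prime p -> ~~ (p * p %| p`!)%N.
Proof.
move=> p_pr; have p0 := prime_gt0 p_pr.
rewrite -{3}(prednK p0) factS prednK// dvdn_pmul2l//.
rewrite -prime_coprime// coprime_sym.
suff h n : (n < p)%N -> coprime n`! p by apply: h; rewrite prednK.
elim: n => [|n IHn] np; first by rewrite coprime1n.
rewrite factS coprimeMl IHn ?(ltnW np)// andbT coprime_sym prime_coprime//.
by apply/negP => /dvdn_leq; lia.
Qed.

(* Otherwise <a> A would have order d |A|, divisible by d^2, in a group of order d!. *)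
Lemma mem_normal_prime_degree (a : 'S_d) : prime d -> #[a]%g = d ->
  (d %| #|A|)%N -> a \in 'N(A)%g -> a \in A.
Proof.
move=> d_pr oa dA aN; apply: contraT => aA; exfalso.
have aI : (<[a]> :&: A = 1)%g.
  by apply: prime_TIg; rewrite ?cycle_subG// -orderE oa.
have : (#|<[a]> * A|)%g = (d * #|A|)%N by rewrite TI_cardMg// -orderE oa.
rewrite -norm_joinEl ?cycle_subG// => E.
have := cardSg (finset.subsetT (<[a]> <*> A)%g); rewrite /= cardsT E card_Sn.
move=> h; have /negP := dvdn_square_fact d_pr; apply.
by apply: dvdn_trans h; exact: dvdn_mul.
Qed.

End normal_subgroups_of_prime_degree.

(** * A single factor generated by the d-cycle and the 3-cycle *)

Section neumann_factor.
Variables (d r : nat).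
Hypotheses (d_pr : prime d) (d_ge5 : (5 <= d)%N) (r_gt0 : (0 < r)%N)
  (r3_le : (3 * r <= d)%N).
Let d_gt0 : (0 < d)%N := prime_gt0 d_pr.
Local Notation pt := (pt d_gt0).
Local Notation a := (cycle_perm d).
Local Notation b := (cyc3 d 0 r (2 * r)).

Lemma order_cycle_perm : #[a]%g = d.
Proof.
have : (#[a]%g %| d)%N.
  rewrite order_dvdn; apply/eqP/permP => z.
  by rewrite -(pt_val d_gt0 z) cycle_permX_pt pt_addK perm1.
case/primeP: (d_pr) => _ dP /dP /orP[|/eqP//]; rewrite order_eq1 => /eqP a1.
have := cycle_perm_pt d_gt0 0; rewrite a1 perm1 add0r => /eqP.
by rewrite pt_eq sub0r dvdzE abszN /= dvdn1; lia.
Qed.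

Lemma cycle_perm_transitive x y : exists k, (a ^+ k)%g x = y.
Proof.
exists ((d - x) + y)%N; rewrite -{2}(pt_val d_gt0 x) cycle_permX_pt.
transitivity (pt y%:Z); last exact: pt_val.
by rewrite -[RHS]pt_addK; congr (_ _); have := ltn_ord x; lia.
Qed.

(** A prime at least 5 is not a multiple of 3. Strictness makes 0, r, 2r, 3r four distinct
    points. *)
Lemma r3_lt : (3 * r < d)%N.
Proof.
rewrite ltn_neqAle r3_le andbT; apply/eqP => e.
have : (3 %| d)%N by rewrite -e dvdn_mulr.
by rewrite dvdn_prime2//; lia.
Qed.

Lemma cyc3_conj_shift : (b ^ (a ^+ r))%g =
  (tperm (pt (2 * r%:Z)) (pt (3 * r%:Z)) * tperm (pt r%:Z) (pt (2 * r%:Z)))%g.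
Proof.
rewrite (cyc3E d_gt0)// conjMg !tpermJ !cycle_permX_pt.
by congr (tperm (pt _) (pt _) * tperm (pt _) (pt _))%g; lia.
Qed.

Lemma cyc3_cube : (b ^+ 3 = 1)%g.
Proof.
apply/permP => z; rewrite perm1 !expgS expg0 mulg1 !permM.
have [[c ->]|h] := pselect (exists c : 'I_3, z = pt (c%:Z * r%:Z)).
  rewrite !cyc3_pt0//; congr (pt (_ * _)).
  by case: c => [[|[|[|]]] ?].
by rewrite !(@cyc3_fix d d_gt0)// => c; apply/eqP => e; apply: h; exists c.
Qed.

(** The commutator is conjugate to the double transposition x y, so [A] is nontrivial and contains
    [a] by the prime degree argument. Then x^-1 y lies in [A], hence so do x^2 and x = x^4. *)
Lemma neumann_factor_normal (A : {group 'S_d}) :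
  (a \in 'N(A) -> b \in 'N(A) -> [~ b, b ^ (a ^+ r)] \in A -> a \in A /\ b \in A)%g.
Proof.
set x := b; set y := (x ^ (a ^+ r))%g => aN xN cA.
have x3 : (x ^+ 3 = 1)%g := cyc3_cube.
have y3 : (y ^+ 3 = 1)%g by rewrite /y -conjXg x3 conj1g.
have n12 : (pt r%:Z != pt (2 * r%:Z)).
  by rewrite pt_eq dvdzE; apply/negP => /dvdn_leq; have := r3_lt; lia.
have n01 : (pt 0 != pt r%:Z).
  by rewrite pt_eq dvdzE; apply/negP => /dvdn_leq; have := r3_lt; lia.
have n02 : (pt 0 != pt (2 * r%:Z)).
  by rewrite pt_eq dvdzE; apply/negP => /dvdn_leq; have := r3_lt; lia.
have n03 : (pt 0 != pt (3 * r%:Z)).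
  by rewrite pt_eq dvdzE; apply/negP => /dvdn_leq; have := r3_lt; lia.
have n13 : (pt r%:Z != pt (3 * r%:Z)).
  by rewrite pt_eq dvdzE; apply/negP => /dvdn_leq; have := r3_lt; lia.
have n23 : (pt (2 * r%:Z) != pt (3 * r%:Z)).
  by rewrite pt_eq dvdzE; apply/negP => /dvdn_leq; have := r3_lt; lia.
(* x and y generate the alternating group on 0, r, 2r, 3r, and x y is an involution. *)
have xyE : (x * y = tperm (pt 0) (pt (2 * r%:Z)) * tperm (pt r%:Z) (pt (3 * r%:Z)))%g.
  rewrite /y cyc3_conj_shift /x (cyc3E d_gt0)//.
  set t := tperm (pt r%:Z) _; rewrite !mulgA.
  have -> : (t * tperm (pt 0) (pt r%:Z) * tperm (pt (2 * r%:Z)) (pt (3 * r%:Z)) * t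
     = (tperm (pt 0) (pt r%:Z) * tperm (pt (2 * r%:Z)) (pt (3 * r%:Z))) ^ t)%g.
    by rewrite /conjg tpermV !mulgA.
  rewrite conjMg !tpermJ /t tpermL tpermR; congr (tperm _ _ * tperm _ _)%g.
    by rewrite tpermD// eq_sym.
  by rewrite tpermD// eq_sym.
have xy2 : (x * y * (x * y) = 1)%g.
  rewrite xyE -mulgA (mulgA (tperm (pt r%:Z) _)).
  have -> : (tperm (pt r%:Z) (pt (3 * r%:Z)) * tperm (pt 0) (pt (2 * r%:Z)) =
             tperm (pt 0) (pt (2 * r%:Z)) * tperm (pt r%:Z) (pt (3 * r%:Z)))%g.
    by rewrite conjgC tpermJ !tpermD// eq_sym.
  by rewrite !mulgA tperm2 mul1g tperm2.
have xy1 : (x * y != 1)%g.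
  apply/eqP => /permP /(_ (pt 0)); rewrite xyE permM perm1 tpermL tpermD// 1?eq_sym//.
  by move/eqP; rewrite eq_sym (negbTE n02).
(* From x y = y^-1 x^-1, y^-2 = y and x^-1 = x^2, the commutator becomes x^-1 y x^-1 = x (x y)
   x^-1. *)
have cE : ([~ x, y] = (x * y) ^ x^-1)%g.
  have yx : (x * y = y^-1 * x^-1)%g.
    by rewrite -invMg; apply: (mulgI (x * y)%g); rewrite xy2 mulgV.
  have xV : (x^-1 = x * x)%g by apply: (mulgI x); rewrite mulgV -[RHS]/(x ^+ 3)%g x3.
  have yV : (y^-1 * y^-1 = y)%g.
    by apply: (mulIg (y * y)%g); rewrite mulgA mulgVK mulVg -[RHS]/(y ^+ 3)%g y3.
  by rewrite commgEl /conjg invgK [in LHS]yx [(y^-1 * (_ * _))%g]mulgA yV {1}xV !mulgA.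
have xyA : (x * y \in A)%g by move: cA; rewrite cE memJ_norm ?groupV.
have A1 : (A :!=: 1)%g.
  by apply/trivgPn; exists (x * y)%g.
have aA : a \in A.
  apply: mem_normal_prime_degree => //; first exact: order_cycle_perm.
  by apply: (@dvdn_prime_degree _ _ a) => //; exact: cycle_perm_transitive.
split => //.
(* This is the commutator of x with a^r, where a^r is now in [A] and x normalises [A]. *)
have xyA' : (x^-1 * y \in A)%g.
  by rewrite /y -commgEl commgEr groupM ?groupX// memJ_norm ?groupV ?groupX.
have : (x * y * (x^-1 * y)^-1 \in A)%g by rewrite groupM ?groupV.
rewrite invMg invgK mulgA mulgK => x2A.
have -> : x = (x * x * (x * x))%g.
  by rewrite -mulgA -[X in (_ * X)%g]/(x ^+ 3)%g x3 mulg1.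
by rewrite groupM.
Qed.

End neumann_factor.

(** * Products of translated 3-cycles over a window *)

Section window_permutations.
Variables (d : nat) (d_gt0 : (0 < d)%N) (r : nat).
Local Notation pt := (pt d_gt0).
(* For |y| < r, the cells (y, 0), (y, 1), (y, 2) are the points that the [y]-th
   translate of the 3-cycle permutes. *)
Definition cell (y : int) (c : 'Z_3) : 'I_d := pt (y + c%:Z * r%:Z).
Implicit Types (s : int) (m : nat) (v w : int -> 'Z_3) (u t : 'S_d).

(* [u] is the product over [y] in the window [s, s + m) of the [v y]-th powers of
   the [y]-th translates of the 3-cycle. *)
Definition rotates s m u v :=
  (forall y c, s <= y < s + m%:Z -> u (cell y c) = cell y (c + v y)) /\
  (forall z, (forall y c, s <= y < s + m%:Z -> z != cell y c) -> u z = z).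

Lemma rotates1 s m : rotates s m 1%g (fun=> 0).
Proof. by split=> [y c _|z _]; rewrite perm1 ?addr0. Qed.

Lemma rotatesM s m u t v w : rotates s m u v -> rotates s m t w ->
  rotates s m (u * t)%g (fun y => v y + w y).
Proof.
move=> [u1 u2] [t1 t2]; split=> [y c ys|z zs]; rewrite permM.
  by rewrite u1// t1// addrA.
by rewrite u2// t2.
Qed.

Lemma rotatesV s m u v : rotates s m u v -> rotates s m u^-1%g (fun y => - v y).
Proof.
move=> [u1 u2]; split=> [y c ys|z zs]; apply: (@perm_inj _ u); rewrite permKV.
  by rewrite u1// subrK.
by rewrite u2.
Qed.

(** Every point is in a cell of the window or is fixed. Commuting and triviality at a coordinate
    thus reduce to identities between lamp functions. *)
Lemma rotates_uniq s m u t v w :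
  (forall y, s <= y < s + m%:Z -> v y = w y) ->
  rotates s m u v -> rotates s m t w -> u = t.
Proof.
move=> vw [u1 u2] [t1 t2]; apply/permP => z.
have [[y [c [ys ->]]]|h] :=
    pselect (exists y (c : 'Z_3), s <= y < s + m%:Z /\ z = cell y c).
  by rewrite u1// t1// vw.
have zs y (c : 'Z_3) : s <= y < s + m%:Z -> z != cell y c.
  by move=> ys; apply/eqP => e; apply: h; exists y, c.
by rewrite u2// t2.
Qed.

Lemma rotates_ext s m u v w : (forall y, s <= y < s + m%:Z -> v y = w y) ->
  rotates s m u v -> rotates s m u w.
Proof. by move=> vw [u1 u2]; split=> // y c ys; rewrite u1// vw. Qed.

Lemma rotates_conj s m u v : rotates s m u v ->
  rotates (s + 1) m (u ^ cycle_perm d)%g (fun y => v (y - 1)).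
Proof.
have e y (c : 'Z_3) : cell y c = cycle_perm d (cell (y - 1) c).
  by rewrite /cell cycle_perm_pt; congr pt; lia.
move=> [u1 u2]; split=> [y c ys|z zs].
  by rewrite e permJ u1 -?e//; lia.
rewrite -(permKV (cycle_perm d) z) permJ u2 // => y c ys.
apply/eqP => h.
have := zs (y + 1) c; rewrite e addrK -h permKV eqxx => /(_ _)/negP; apply => //.
by lia.
Qed.

Lemma rotates_conjV s m u v : rotates s m u v ->
  rotates (s - 1) m (u ^ (cycle_perm d)^-1)%g (fun y => v (y + 1)).
Proof.
have e y (c : 'Z_3) : cell y c = (cycle_perm d)^-1%g (cell (y + 1) c).
  by rewrite /cell cycle_permV_pt; congr pt; lia.
move=> [u1 u2]; split=> [y c ys|z zs].
  by rewrite e permJ u1 -?e//; lia.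
rewrite -(permKV (cycle_perm d)^-1%g z) permJ u2 // => y c ys.
apply/eqP => h.
have := zs (y - 1) c; rewrite e subrK -h permKV eqxx => /(_ _)/negP; apply => //.
by lia.
Qed.

Lemma rotates_conjX k s m u v : rotates s m u v ->
  rotates (s + k%:Z) m (u ^ (cycle_perm d ^+ k))%g (fun y => v (y - k%:Z)).
Proof.
elim: k => [|k IHk] h.
  by rewrite addr0 expg0 conjg1; apply: rotates_ext h => y _; rewrite subr0.
have := rotates_conj (IHk h); rewrite expgSr conjgM.
rewrite (_ : s + k%:Z + 1 = s + k.+1%:Z); last by lia.
by apply: rotates_ext => y _; congr v; lia.
Qed.

Definition bump0 : int -> 'Z_3 := fun y => if y == 0 then 1 else 0.

Hypotheses (r_gt0 : (0 < r)%N) (r3_le : (3 * r <= d)%N).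

Lemma cyc3_cell y (c : 'Z_3) : `|y| < r%:Z ->
  cyc3 d 0 r (2 * r) (cell y c) = cell y (c + bump0 y).
Proof.
move=> yr; rewrite /bump0; case: eqVneq => [->|y0].
  rewrite /cell !add0r (cyc3_pt0 d_gt0)//; congr (pt (_ * _)).
  by case: c => [[|[|[|]]] ?].
rewrite addr0 (@cyc3_fix d d_gt0 r) // => c'; apply/eqP => e.
move/eqP: y0; apply; apply: (proj1 (@pt_inj d d_gt0 r r_gt0 r3_le y 0 c c' _ _)).
  by rewrite subr0.
by rewrite add0r.
Qed.

(** Length at most [r] keeps the cells of the window disjoint, so only those with y = 0 are
    moved. *)
Lemma rotates_cyc3 s m : s <= 0 < s + m%:Z -> (m <= r)%N ->
  rotates s m (cyc3 d 0 r (2 * r)) bump0.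
Proof.
move=> s0 mr; split=> [y c ys|z zs]; first by apply: cyc3_cell; lia.
by apply: (@cyc3_fix d d_gt0 r) => // c; have := zs 0 c s0; rewrite /cell add0r.
Qed.

End window_permutations.
(** * Lamp functions *)

Section fold.
Variables (M : nat) (V : zmodType).
Implicit Types (v w : int -> V) (x y k : int).

Definition finsupp v := finite_set [set x | v x <> 0].

Lemma finsupp_bounded v (c : nat) : (forall x, c%:Z < `|x| -> v x = 0) -> finsupp v.
Proof.
move=> vc; apply: (@sub_finite_set _ _ ((fun i : nat => i%:Z - c%:Z) @` `I_(c + c).+1)).
  move=> x /= vx; have xc : `|x| <= c%:Z.
    by rewrite leNgt; apply/negP => /vc.
  by exists `|(x + c%:Z)%R|%N; rewrite /=; lia.
exact: finite_image.
Qed.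

Lemma finsuppD v w : finsupp v -> finsupp w -> finsupp (fun x => v x + w x).
Proof.
move=> fv fw; apply: (@sub_finite_set _ _ ([set x | v x <> 0] `|` [set x | w x <> 0])).
  move=> x /= vw; have [v0|v0] := pselect (v x = 0); last by left.
  by right => w0; apply: vw; rewrite v0 w0 addr0.
by rewrite finite_setU.
Qed.

Lemma finsuppN v : finsupp v -> finsupp (fun x => - v x).
Proof. by apply: sub_finite_set => x /= h v0; apply: h; rewrite v0 oppr0. Qed.

Lemma finsupp_shift v k : finsupp v -> finsupp (fun x => v (x + k)).
Proof.
move=> fv; apply: (@sub_finite_set _ _ ((fun x => x - k) @` [set x | v x <> 0])).
  by move=> x /= vx; exists (x + k); rewrite /= ?addrK.
exact: finite_image.
Qed.

(** The lamp function induced on Z/M, kept as an M-periodic function on the integers. *)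
Definition fold v y := \sum_(x \in [set: int]) (if (M %| x - y)%Z then v x else 0).

Lemma fold_widen v y (D : set int) : [set x | v x <> 0] `<=` D ->
  fold v y = \sum_(x \in D) (if (M %| x - y)%Z then v x else 0).
Proof.
move=> vD; apply/esym; apply: fsbig_widen => // x [_ Dx] /=.
case: ifP => // _; apply: contrapT => vx; exact/Dx/vD.
Qed.

Lemma foldD v w y : finsupp v -> finsupp w ->
  fold (fun x => v x + w x) y = fold v y + fold w y.
Proof.
move=> fv fw; pose D := [set x | v x <> 0] `|` [set x | w x <> 0].
have fD : finite_set D by rewrite finite_setU.
rewrite !(@fold_widen _ _ D); last 3 first.
- by move=> x; right.
- by move=> x; left.
- move=> x /= vw; have [v0|v0] := pselect (v x = 0); last by left.
  by right => w0; apply: vw; rewrite v0 w0 addr0.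
rewrite -fsbig_split//; apply: eq_fsbigr => x _.
by case: ifP => //= _; rewrite addr0.
Qed.

Lemma fold0 y : fold (fun=> 0) y = 0.
Proof. by apply: fsbig1 => x _; case: ifP. Qed.

Lemma foldN v y : finsupp v -> fold (fun x => - v x) y = - fold v y.
Proof.
move=> fv; apply/eqP; rewrite -addr_eq0 -foldD//; last exact: finsuppN.
by rewrite (_ : (fun x => _) = fun=> 0) ?fold0//; apply/funext => x; rewrite addNr.
Qed.

Lemma fold_shift v k y : fold (fun x => v (x + k)) y = fold v (y + k).
Proof.
rewrite [RHS](reindex_fsbigT (fun x => x + k)); last first.
  by exists (fun x => x - k) => x; rewrite ?addrK ?subrK.
by apply: eq_fsbigr => x _; rewrite (_ : x + k - (y + k) = x - y)//; lia.
Qed.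

Lemma fold_period v y y' : (M %| y - y')%Z -> fold v y = fold v y'.
Proof.
move=> yy'; apply: eq_fsbigr => x _.
by rewrite -(subrKA y x (- y')) (rpredDr _ yy').
Qed.

(** Serves lamp functions supported in a window of length [M], about which folding loses nothing. *)
Lemma fold_single v x0 y : (M %| x0 - y)%Z ->
  (forall x, v x <> 0 -> (M %| x - y)%Z -> x = x0) -> fold v y = v x0.
Proof.
move=> x0y v0; rewrite /fold -(@fsbig_widen _ _ _ _ [set x0])//.
  by rewrite fsbig_set1 x0y.
move=> x [_ xx0] /=; case: ifP => // xy; apply: contrapT => vx.
by apply: xx0; exact: v0.
Qed.

End fold.
(** * The group generated by alpha and beta *)

Section group_structure.
Variables (d r : nat -> nat).

Lemma Gt_eq (x y : Gt d r) : (forall n, sval x n = sval y n) -> x = y.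
Proof.
case: x y => [x hx] [y hy] /= h; have xy := functional_extensionality_dep h.
by subst y; congr exist; exact: Prop_irrelevance.
Qed.

HB.instance Definition _ := gen_eqMixin (Gt d r).
HB.instance Definition _ := gen_choiceMixin (Gt d r).

Lemma GmulA : associative (@Gmul d r).
Proof. by move=> x y z; apply: Gt_eq => n; exact: mulgA. Qed.

Lemma Gmul1 : left_id (Gone d r) (@Gmul d r).
Proof. by move=> x; apply: Gt_eq => n; exact: mul1g. Qed.

Lemma Gmulr1 : right_id (Gone d r) (@Gmul d r).
Proof. by move=> x; apply: Gt_eq => n; exact: mulg1. Qed.

Lemma GmulV : left_inverse (Gone d r) (@Ginv d r) (@Gmul d r).
Proof. by move=> x; apply: Gt_eq => n; exact: mulVg. Qed.

Lemma GmulrV : right_inverse (Gone d r) (@Ginv d r) (@Gmul d r).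
Proof. by move=> x; apply: Gt_eq => n; exact: mulgV. Qed.

HB.instance Definition _ :=
  isGroup.Build (Gt d r) GmulA Gmul1 Gmulr1 GmulV GmulrV.

Definition Galpha : Gt d r := exist _ (alpha d) (@inG_alpha d r).

Lemma Gt_ind_gen (S : Gt d r -> Prop) :
  S Galpha -> S (Gbeta d r) -> S 1%g ->
  (forall x y, S x -> S y -> S (x * y)%g) -> (forall x, S x -> S x^-1%g) ->
  forall x, S x.
Proof.
move=> Sa Sb S1 SM SV [x hx].
(* The induction runs on bare sequences, so the membership proof is quantified inside and later
   identified by proof irrelevance. *)
suff h : forall y, inG r y -> exists hy : inG r y, S (exist _ y hy).
  by have [hx' Sx] := h x hx; rewrite (Prop_irrelevance hx hx').
move=> y; elim => [||| u w _ [hu Su] _ [hw Sw]|u _ [hu Su]].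
- by eexists; exact: Sa.
- by eexists; exact: Sb.
- by eexists; exact: S1.
- by eexists; exact: SM Su Sw.
- by eexists; exact: SV Su.
Qed.

Lemma coordX (x : Gt d r) k n : sval (x ^+ k)%g n = (sval x n ^+ k)%g.
Proof. by elim: k => [|k IHk] //; rewrite !expgS -IHk. Qed.

Lemma coordJ (x y : Gt d r) n : sval (x ^ y)%g n = (sval x n ^ sval y n)%g.
Proof. by []. Qed.

Lemma inLinfM (x y : Gt d r) : inLinf x -> inLinf y -> inLinf (x * y)%g.
Proof. exact: L_mul. Qed.

Lemma inLinfV (x : Gt d r) : inLinf x -> inLinf x^-1%g.
Proof. exact: L_inv. Qed.

Lemma inLinf1 : inLinf (1%g : Gt d r).
Proof. exact: L_one. Qed.

Lemma inLinfJ (g x : Gt d r) : inLinf x -> inLinf (x ^ g)%g.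
Proof. by move=> /(L_conj g); rewrite /conjg mulgA. Qed.

End group_structure.

(** * Elements of L with finitely many nontrivial coordinates *)

Section neumann_group.
Variables (d r : nat -> nat).
Hypothesis hd_prime : forall n, prime (d n).
Hypothesis hd_ge5 : forall n, (5 <= d n)%N.
Hypothesis hr_pos : forall n, (0 < r n)%N.
Hypothesis hr_incr : forall m n, (m < n)%N -> (r m < r n)%N.
Hypothesis hrd : forall n, (3 * r n <= d n)%N.
Local Notation G := (Gt d r).
Local Notation a := (Galpha d r).
Local Notation b := (Gbeta d r).
Let d_gt0 n : (0 < d n)%N := prime_gt0 (hd_prime n).

Lemma r_ge n : (n < r n)%N.
Proof.
elim: n => [|n IHn]; first exact: hr_pos.
by apply: leq_ltn_trans IHn (hr_incr _).
Qed.

(* At a coordinate n > N the two 3-cycles have disjoint supports. *)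
Lemma commutator_beta_coord N n : (N < n)%N ->
  sval [~ b, b ^ (a ^+ r N)]%g n = 1%g.
Proof.
move=> Nn; have rNn := hr_incr Nn.
suff : commute (sval b n) (sval (b ^ (a ^+ r N))%g n).
  by move/commgP/eqP.
rewrite coordJ coordX.
have h1 : rotates (d_gt0 n) (r n) 0 (r N).+1 (sval b n) bump0.
  by apply: rotates_cyc3 => //; lia.
have h2 : rotates (d_gt0 n) (r n) 0 (r N).+1 (sval b n ^ (sval a n ^+ r N))%g
    (fun y => bump0 (y - (r N)%:Z)).
  have h : rotates (d_gt0 n) (r n) (- (r N)%:Z) (r N).+1 (sval b n) bump0.
    by apply: rotates_cyc3 => //; lia.
  by have := rotates_conjX (r N) h; rewrite addNr.
apply: rotates_uniq (rotatesM h1 h2) (rotatesM h2 h1) => y _.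
exact: addrC.
Qed.

(** The values at [N] of the elements of L trivial elsewhere form a group [A] normalised by the N-th
    factor. Once [A] contains the commutator of the two 3-cycles, [neumann_factor_normal] puts both
    generators in it. *)
Lemma single_coord N :
  (forall g : G, exists2 l : G, inLinf l &
     forall n, sval l n = if (n < N)%N then sval g n else 1%g) ->
  forall g : G, exists2 l : G, inLinf l &
     sval l N = sval g N /\ forall n, n != N -> sval l n = 1%g.
Proof.
move=> trunc.
pose Q (s : {perm 'I_(d N)}) := exists2 l : G, inLinf l &
  sval l N = s /\ forall n, n != N -> sval l n = 1%g.
pose A := [set s | `[< Q s >]]%SET.
have AP s : reflect (Q s) (s \in A) by rewrite inE; exact: asboolP.
have gA : group_set A.
  apply/group_setP; split.
    by apply/AP; exists 1%g; [exact: inLinf1|split].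
  move=> s t /AP[l Ll [ls l1]] /AP[l' Ll' [ls' l1']]; apply/AP.
  exists (l * l')%g; first exact: inLinfM.
  split=> [|n nN]; first by rewrite -ls -ls'.
  by rewrite -[LHS]/(sval l n * sval l' n)%g l1// l1'// mulg1.
have AJ (g : G) : sval g N \in 'N(A)%g.
  rewrite inE; apply/fintype.subsetP => _ /imsetP[s /AP[l Ll [ls l1]] ->]; apply/AP.
  exists (l ^ g)%g; first exact: inLinfJ.
  by split=> [|n nN]; rewrite coordJ ?ls// l1// conj1g.
have cA : ([~ sval b N, sval b N ^ (sval a N ^+ r N)] \in A)%g.
  (* [e] is trivial above [N]; dividing by its truncation removes the coordinates below [N]. *)
  pose e : G := [~ b, b ^ (a ^+ r N)]%g.
  have Le : inLinf e.
    by apply: inLinfM; [exact/inLinfV/L_beta|apply: inLinfJ; exact: L_beta].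
  have [l Ll lE] := trunc e.
  apply/AP; exists (e * l^-1)%g; first exact/inLinfM/inLinfV.
  split=> [|n nN].
    rewrite -[LHS]/(sval e N * (sval l N)^-1)%g lE ltnn invg1 mulg1.
    by rewrite -coordX.
  rewrite -[LHS]/(sval e n * (sval l n)^-1)%g lE; case: ltnP => nN'.
    by rewrite mulgV.
  by rewrite commutator_beta_coord ?invg1 ?mulg1// ltn_neqAle eq_sym nN.
have [aA bA] := @neumann_factor_normal (d N) (r N) (hd_prime N) (hd_ge5 N)
  (hr_pos N) (hrd N) (Group gA) (AJ a) (AJ b) cA.
move=> g; apply/AP; move: g; apply: Gt_ind_gen => //.
- exact: group1 (Group gA).
- by move=> x y xA yA; exact: (groupM (G := Group gA) xA yA).
- by move=> x xA; rewrite -[sval _ N]/((sval x N)^-1)%g (groupV (Group gA)).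
Qed.

(** By induction, the truncation below [N] is multiplied by an element concentrated at coordinate
    [N]. *)
Lemma truncation N (g : G) : exists2 l : G, inLinf l &
  forall n, sval l n = if (n < N)%N then sval g n else 1%g.
Proof.
elim: N g => [|N IHN] g; first by exists 1%g; [exact: inLinf1|].
have [l Ll lE] := IHN g; have [l' Ll' [l'N l'1]] := single_coord IHN g.
exists (l * l')%g; first exact: inLinfM.
move=> n; rewrite -[LHS]/(sval l n * sval l' n)%g lE ltnS.
case: (ltngtP n N) => [nN|nN|->]; last by rewrite mul1g.
  by rewrite l'1 ?mulg1// ltn_eqF.
by rewrite l'1 ?mulg1// gtn_eqF.
Qed.

(** * The homomorphism to the lamplighter group *)

Local Notation cl n := (cell (d_gt0 n) (r n)).

Lemma cell_inj n y y' c c' : `|y - y'| < (r n)%:Z ->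
  cl n y c = cl n y' c' -> y = y' /\ c = c'.
Proof. exact: pt_inj. Qed.

(* Far out in the sequence, [g] acts near the points 0, r, 2r like the lamplighter
   element with translation part [k] and lamp function [v]. *)
Definition germ (g : G) (k : int) (v : int -> 'Z_3) :=
  finsupp v /\ forall B : nat, exists N, forall n y c, (N <= n)%N -> `|y| <= B%:Z ->
    sval g n (cl n y c) = cl n (y + k) (c + v y).

Lemma germ_uniq g k v k' v' : germ g k v -> germ g k' v' -> k = k' /\ v = v'.
Proof.
move=> [_ h] [_ h'].
suff e y : k = k' /\ v y = v' y.
  by split; [exact: (e 0).1|apply/funext => y; exact: (e y).2].
have [N hN] := h `|y|%N; have [N' hN'] := h' `|y|%N.
(* Beyond both thresholds, and with r n > n >= |k - k'|, so that [cell_inj] applies. *)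
pose n := (N + N' + `|(k - k')%R|)%N.
have E : cl n (y + k) (0 + v y) = cl n (y + k') (0 + v' y).
  by rewrite -hN -?hN'// /n; lia.
have := cell_inj _ E; rewrite !add0r => -[|/addrI ? ?//].
by have := r_ge n; rewrite /n; lia.
Qed.

Lemma germ_one : germ 1%g 0 (fun=> 0).
Proof.
split; first by apply: (@finsupp_bounded _ _ 0).
by move=> B; exists 0%N => n y c _ _; rewrite perm1 !addr0.
Qed.

Lemma germ_mul g g' k k' v v' : germ g k v -> germ g' k' v' ->
  germ (g * g')%g (k + k') (fun y => v y + v' (y + k)).
Proof.
move=> [fv h] [fv' h']; split; first exact/finsuppD/finsupp_shift.
move=> B; have [N hN] := h B; have [N' hN'] := h' (B + `|k|)%N.
exists (N + N')%N => n y c nN yB.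
by rewrite permM hN ?hN' ?addrA//; lia.
Qed.

Lemma germ_inv g k v : germ g k v -> germ g^-1%g (- k) (fun y => - v (y - k)).
Proof.
move=> [fv h]; split; first by apply: finsuppN; exact: finsupp_shift.
move=> B; have [N hN] := h (B + `|k|)%N.
exists N => n y c nN yB; apply: (@perm_inj _ (sval g n)); rewrite permKV.
by rewrite hN ?subrK//; lia.
Qed.

Lemma germ_alpha : germ a 1 (fun=> 0).
Proof.
split; first by apply: (@finsupp_bounded _ _ 0).
move=> B; exists 0%N => n y c _ _; rewrite /cell -[sval a n]/(cycle_perm (d n)).
by rewrite cycle_perm_pt addr0; congr pt; lia.
Qed.

Lemma germ_beta : germ b 0 bump0.
Proof.
split.
  by apply: (@finsupp_bounded _ _ 0) => x x0; rewrite /bump0; case: eqP x0 => // ->.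
move=> B; exists B => n y c nB yB; rewrite addr0 /=.
by apply: cyc3_cell => //; have := r_ge n; lia.
Qed.

Lemma germ_ex g : exists kv : int * (int -> 'Z_3), germ g kv.1 kv.2.
Proof.
move: g; apply: Gt_ind_gen.
- by exists (1, fun=> 0); exact: germ_alpha.
- by exists (0, bump0); exact: germ_beta.
- by exists (0, fun=> 0); exact: germ_one.
- move=> x y [[k v] /= hx] [[k' v'] /= hy].
  by exists (k + k', fun y => v y + v' (y + k)); exact: germ_mul.
- move=> x [[k v] /= hx].
  by exists (- k, fun y => - v (y - k)); exact: germ_inv.
Qed.

(** [gk] and [gv] are the translation and lamp parts of the image in the lamplighter group;
    [germ_uniq] makes the choice canonical. *)
Definition gk g := (projT1 (cid (germ_ex g))).1.
Definition gv g := (projT1 (cid (germ_ex g))).2.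

Lemma germP g : germ g (gk g) (gv g).
Proof. exact: projT2 (cid (germ_ex g)). Qed.

Lemma germE g k v : germ g k v -> gk g = k /\ gv g = v.
Proof. exact: germ_uniq (germP g). Qed.

Lemma finsupp_gv g : finsupp (gv g).
Proof. by case: (germP g). Qed.

Lemma gkM x y : gk (x * y)%g = gk x + gk y.
Proof. exact: (germE (germ_mul (germP x) (germP y))).1. Qed.

Lemma gvM x y : gv (x * y)%g = fun z => gv x z + gv y (z + gk x).
Proof. exact: (germE (germ_mul (germP x) (germP y))).2. Qed.

Lemma gkV x : gk x^-1%g = - gk x.
Proof. exact: (germE (germ_inv (germP x))).1. Qed.

Lemma gvV x : gv x^-1%g = fun z => - gv x (z - gk x).
Proof. exact: (germE (germ_inv (germP x))).2. Qed.

Lemma gk1 : gk 1%g = 0. Proof. exact: (germE germ_one).1. Qed.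
Lemma gv1 : gv 1%g = fun=> 0. Proof. exact: (germE germ_one).2. Qed.
Lemma gka : gk a = 1. Proof. exact: (germE germ_alpha).1. Qed.
Lemma gva : gv a = fun=> 0. Proof. exact: (germE germ_alpha).2. Qed.
Lemma gkb : gk b = 0. Proof. exact: (germE germ_beta).1. Qed.
Lemma gvb : gv b = bump0. Proof. exact: (germE germ_beta).2. Qed.

Lemma gkX x n : gk (x ^+ n)%g = gk x *+ n.
Proof. by elim: n => [|n IHn]; rewrite ?gk1// expgS gkM IHn mulrS. Qed.

Lemma gvaX n : gv (a ^+ n)%g = fun=> 0.
Proof.
elim: n => [|n IHn]; first by rewrite expg0 gv1.
by rewrite expgS gvM IHn gva; apply/funext => z; rewrite addr0.
Qed.

Lemma gkJ x g : gk (x ^ g)%g = gk x.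
Proof. by rewrite /conjg !gkM gkV addrC addrK. Qed.

Lemma gvJa x : gv (x ^ a)%g = fun z => gv x (z - 1).
Proof.
rewrite /conjg !gvM gvV gkV gka gva; apply/funext => z.
by rewrite oppr0 add0r addr0.
Qed.

Lemma gvJaV x : gv (x ^ a^-1)%g = fun z => gv x (z + 1).
Proof.
rewrite /conjg invgK !gvM gvV gka gva; apply/funext => z.
by rewrite oppr0 add0r addr0.
Qed.

Lemma germ_eventually1 g N : (forall n, (N <= n)%N -> sval g n = 1%g) ->
  gk g = 0 /\ gv g = fun=> 0.
Proof.
move=> g1; apply: germE; split; first by apply: (@finsupp_bounded _ _ 0).
by move=> B; exists N => n y c nN _; rewrite g1// perm1 !addr0.
Qed.

Lemma gk_inLinf g : inLinf g -> gk g = 0.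
Proof.
elim=> [||x y _ hx _ hy|x _ hx|h x _ hx].
- exact: gkb.
- exact: gk1.
- by rewrite -[Gmul x y]/(x * y)%g gkM hx hy addr0.
- by rewrite -[Ginv x]/(x^-1)%g gkV hx oppr0.
- by rewrite -[Gmul (Gmul _ _) _]/(h^-1 * x * h)%g -mulgA -[(_ * _)%g]/(x ^ h)%g gkJ.
Qed.

(** Modulo the normal subgroup L the group is generated by alpha. The integer exponent is written as
    a difference of naturals. *)
Lemma alpha_pow_inLinf g : exists i j : nat, inLinf (g * a ^+ i * (a ^- j))%g.
Proof.
have Cij i j : commute (a ^+ i)%g (a ^- j)%g.
  by apply: commuteV; apply: commuteX2; exact: commute_refl.
move: g; apply: Gt_ind_gen.
- by exists 0%N, 1%N; rewrite expg0 mulg1 expg1 mulgV; exact: inLinf1.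
- by exists 0%N, 0%N; rewrite expg0 mulg1 invg1 mulg1; exact: L_beta.
- by exists 0%N, 0%N; rewrite expg0 mulg1 invg1 mulg1; exact: inLinf1.
- move=> x y [i [j Lx]] [i' [j' Ly]]; exists (i' + i)%N, (j' + j)%N.
  have := inLinfM Lx (inLinfJ (a ^+ i * a ^- j)%g Ly).
  have -> : (x * y * a ^+ (i' + i) * a ^- (j' + j) =
      x * y * (a ^+ i' * a ^- j') * (a ^+ i * a ^- j))%g.
    rewrite expgD addnC expgD invMg !mulgA; congr (_ * _)%g.
    by rewrite -!mulgA (Cij i j').
  set c := (a ^+ i * a ^- j)%g; rewrite -(mulgA x _ (a ^- j)%g) -/c /conjg.
  by rewrite -(mulgA x c) mulVKg !mulgA.
- move=> x [i [j Lx]]; exists j, i.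
  have := inLinfJ (a ^+ i * a ^- j)^-1%g (inLinfV Lx).
  rewrite -(mulgA x) [(x * _)^-1%g]invMg /conjg invgK mulgA mulVKg.
  by rewrite invMg invgK mulgA.
Qed.

(** Alpha has translation part 1, so the two exponents agree and cancel. Together with [gk_inLinf],
    L is the kernel of the translation part. *)
Lemma gk0_inLinf g : gk g = 0 -> inLinf g.
Proof.
have [i [j Lij]] := alpha_pow_inLinf g; move=> g0.
have := gk_inLinf Lij; rewrite !gkM gkV !gkX gka g0 add0r => ij.
by move: Lij; rewrite (_ : i = j) ?mulgK//; lia.
Qed.

(** * Locality of the elements of L *)

Local Notation rot n := (rotates (d_gt0 n) (r n)).

(** Unlike [germ], this controls every point: outside the cells of a window around [-B, B] of length
    at most [r n], the n-th coordinate is the identity. *)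
Definition local_in (B : nat) (g : G) :=
  (forall y, B%:Z < `|y| -> gv g y = 0) /\
  forall s m n, s <= - B%:Z -> B%:Z < s + m%:Z -> (m <= r n)%N ->
    rot n s m (sval g n) (gv g).

Lemma local_in_widen B B' g : (B <= B')%N -> local_in B g -> local_in B' g.
Proof.
move=> BB' [h1 h2]; split=> [y yB|s m n sB mB mr]; first by apply: h1; lia.
by apply: h2 => //; lia.
Qed.

Lemma local_inM B x y : gk x = 0 -> local_in B x -> local_in B y -> local_in B (x * y)%g.
Proof.
move=> x0 [x1 x2] [y1 y2].
have vE : gv (x * y)%g = fun z => gv x z + gv y z.
  by rewrite gvM x0; apply/funext => z; rewrite addr0.
split=> [z zB|s m n sB mB mr]; rewrite vE; first by rewrite x1// y1// addr0.
by apply: rotatesM; [exact: x2|exact: y2].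
Qed.

Lemma local_inV B x : gk x = 0 -> local_in B x -> local_in B x^-1%g.
Proof.
move=> x0 [x1 x2].
have vE : gv x^-1%g = fun z => - gv x z.
  by rewrite gvV x0; apply/funext => z; rewrite subr0.
split=> [z zB|s m n sB mB mr]; rewrite vE; first by rewrite x1// oppr0.
by apply: rotatesV; exact: x2.
Qed.

Lemma local_inJa B x : local_in B x -> local_in B.+1 (x ^ a)%g.
Proof.
move=> [x1 x2]; split=> [z zB|s m n sB mB mr]; rewrite gvJa; first by apply: x1; lia.
by rewrite -(subrK 1 s); apply: rotates_conj; apply: x2 => //; lia.
Qed.

Lemma local_inJaV B x : local_in B x -> local_in B.+1 (x ^ a^-1)%g.
Proof.
move=> [x1 x2]; split=> [z zB|s m n sB mB mr]; rewrite gvJaV; first by apply: x1; lia.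
by rewrite -(addrK 1 s); apply: rotates_conjV; apply: x2 => //; lia.
Qed.

Lemma local_in_b : local_in 0 b.
Proof.
rewrite /local_in gvb; split=> [y y0|s m n sB mB mr].
  by rewrite /bump0; case: eqP y0 => // ->.
by apply: rotates_cyc3 => //; lia.
Qed.

Definition local_elt (x : G) := gk x = 0 /\ exists B, local_in B x.

Lemma local_eltM x y : local_elt x -> local_elt y -> local_elt (x * y)%g.
Proof.
move=> [x0 [B xB]] [y0 [B' yB]]; split; first by rewrite gkM x0 y0 addr0.
exists (maxn B B'); apply: local_inM => //.
  by apply: local_in_widen xB; exact: leq_maxl.
by apply: local_in_widen yB; exact: leq_maxr.
Qed.

Lemma local_eltV x : local_elt x -> local_elt x^-1%g.
Proof.
move=> [x0 [B xB]]; split; first by rewrite gkV x0 oppr0.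
by exists B; exact: local_inV.
Qed.

(** Conjugation by [b] stays inside [S] because [b] belongs to it, so only conjugation by [a] and
    its inverse needs checking. *)
Lemma stable_conj (S : G -> Prop) :
  (forall x, S x -> S (x ^ a)%g) -> (forall x, S x -> S (x ^ a^-1)%g) ->
  S b -> (forall x y, S x -> S y -> S (x * y)%g) -> (forall x, S x -> S x^-1%g) ->
  forall g x, S x -> S (x ^ g)%g.
Proof.
move=> Sa SaV Sb SM SV g.
(* Carrying [g] and its inverse together makes the inverse case of the induction a swap. *)
suff [] : (forall x, S x -> S (x ^ g)%g) /\ (forall x, S x -> S (x ^ g^-1)%g) by [].
move: g; apply: Gt_ind_gen => //.
- split=> x Sx; rewrite /conjg ?invgK.
    exact: SM (SV _ Sb) (SM _ _ Sx Sb).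
  exact: SM Sb (SM _ _ Sx (SV _ Sb)).
- by split=> x; rewrite ?invg1 conjg1.
- move=> x y [hx hxV] [hy hyV]; split=> z Sz; rewrite ?invMg conjgM.
    exact/hy/hx.
  exact/hxV/hyV.
- by move=> x [hx hxV]; rewrite invgK.
Qed.

Lemma local_inLinf x : inLinf x -> local_elt x.
Proof.
have lb : local_elt b by split; [exact: gkb|exists 0%N; exact: local_in_b].
have l1 : local_elt 1%g.
  split; first exact: gk1.
  exists 0%N; rewrite /local_in gv1; split=> // s m n _ _ _; exact: rotates1.
elim=> [//|//|u w _ hu _ hw|u _ hu|g u _ hu].
- exact: local_eltM.
- exact: local_eltV.
rewrite -[Gmul (Gmul _ _) _]/(g^-1 * u * g)%g -mulgA -[(_ * _)%g]/(u ^ g)%g.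
apply: (stable_conj _ _ lb local_eltM local_eltV) hu => {}u [u0 [B uB]];
  split; rewrite ?gkJ//; exists B.+1; [exact: local_inJa|exact: local_inJaV].
Qed.

(** * The kernel and the window groups for a fixed window length *)

Section one_window.
Variable m : nat.
Local Notation M := m.+1.

Definition foldv g y := fold M (gv g) y.

Lemma foldvM x y z : foldv (x * y)%g z = foldv x z + foldv y (z + gk x).
Proof.
rewrite /foldv gvM foldD; [|exact: finsupp_gv|exact/finsupp_shift/finsupp_gv].
by rewrite (fold_shift M (gv y)).
Qed.

Lemma foldvV x z : foldv x^-1%g z = - foldv x (z - gk x).
Proof.
rewrite /foldv gvV foldN; last exact/finsupp_shift/finsupp_gv.
by rewrite (fold_shift M (gv x)).
Qed.

Lemma foldv1 z : foldv 1%g z = 0.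
Proof. by rewrite /foldv gv1 fold0. Qed.

Definition Kw : set G := [set g | [/\ forall n, (n < M)%N -> sval g n = 1%g,
  (M %| gk g)%Z & forall y, foldv g y = 0]].

(** For n >= M one has r n > n >= M, so the cells of the window [s, s + M) are disjoint; the earlier
    coordinates are left free. *)
Definition Pw (s : int) : set G := [set g | [/\ inLinf g,
  forall y, ~~ (s <= y < s + M%:Z) -> gv g y = 0 &
  forall n, (M <= n)%N -> rot n s M (sval g n) (gv g)]].

Lemma Kw1 : Kw 1%g.
Proof. by split=> // [|y]; rewrite ?gk1 ?dvdz0// foldv1. Qed.

Lemma KwM x y : Kw x -> Kw y -> Kw (x * y)%g.
Proof.
move=> [x1 xk xv] [y1 yk yv]; split=> [n nM||z].
- by rewrite -[LHS]/(sval x n * sval y n)%g x1// y1// mulg1.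
- by rewrite gkM rpredD.
- by rewrite foldvM xv yv addr0.
Qed.

Lemma KwV x : Kw x -> Kw x^-1%g.
Proof.
move=> [x1 xk xv]; split=> [n nM||z].
- by rewrite -[LHS]/(sval x n)^-1%g x1// invg1.
- by rewrite gkV rpredN.
- by rewrite foldvV xv oppr0.
Qed.

(** The contributions of [g] and its inverse to the folded lamps are offset by [gk x], a multiple of
    the period [M], and cancel. *)
Lemma KwJ x g : Kw x -> Kw (x ^ g)%g.
Proof.
move=> [x1 xk xv]; split=> [n nM||z].
- by rewrite coordJ x1// conj1g.
- by rewrite gkJ.
- rewrite /conjg !foldvM foldvV xv add0r gkV.
  have -> : foldv g (z - gk g + gk x) = foldv g (z - gk g).
    by apply: fold_period; rewrite addrAC subrr add0r.
  by rewrite addNr.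
Qed.

Lemma Kw_finite : exists (Q : finType) (q : G -> Q),
  forall x y, q x = q y -> Kw (x^-1 * y)%g.
Proof.
exists ({dffun forall i : 'I_M, {perm 'I_(d i)}} * 'I_M * {ffun 'I_M -> 'Z_3})%type.
exists (fun g : G => ([ffun i : 'I_M => sval g i], inord `|(gk g %% M)%Z|,
                  [ffun i : 'I_M => foldv g i%:Z])).
move=> x y [/ffunP xy1 /(congr1 val) xy2 /ffunP xy3].
have lt z : (`|(z %% M)%Z| < M)%N by exact: pt_subproof.
have fE z : foldv x z = foldv y z.
  have := xy3 (Ordinal (lt z)); rewrite !ffunE /=.
  have zM : (M %| `|(z %% M)%Z|%:Z - z)%Z.
    by rewrite gez0_abs ?modz_ge0// -eqz_mod_dvd modz_mod.
  by rewrite /foldv !(fold_period _ zM).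
split=> [n nM||z].
- have := xy1 (Ordinal nM); rewrite !ffunE /= => e.
  by rewrite -[LHS]/((sval x n)^-1 * sval y n)%g e mulVg.
- rewrite gkM gkV addrC -eqz_mod_dvd; move: xy2; rewrite /= !inordK// => e.
  apply/eqP; have := modz_ge0 (gk x) (isT : M%:Z != 0).
  by have := modz_ge0 (gk y) (isT : M%:Z != 0); lia.
- by rewrite foldvM foldvV gkV fE addNr.
Qed.

Lemma Pw1 s : Pw s 1%g.
Proof.
by split=> [|y _|n _]; [exact: inLinf1|rewrite gv1|rewrite gv1; exact: rotates1].
Qed.

Lemma PwM s x y : Pw s x -> Pw s y -> Pw s (x * y)%g.
Proof.
move=> [Lx x1 x2] [Ly y1 y2].
have vE : gv (x * y)%g = fun z => gv x z + gv y z.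
  by rewrite gvM gk_inLinf//; apply/funext => z; rewrite addr0.
split=> [|z zs|n nM]; first exact: inLinfM.
  by rewrite vE x1// y1// addr0.
by rewrite vE; apply: rotatesM; [exact: x2|exact: y2].
Qed.

Lemma PwV s x : Pw s x -> Pw s x^-1%g.
Proof.
move=> [Lx x1 x2].
have vE : gv x^-1%g = fun z => - gv x z.
  by rewrite gvV gk_inLinf//; apply/funext => z; rewrite subr0.
split=> [|z zs|n nM]; first exact: inLinfV.
  by rewrite vE x1// oppr0.
by rewrite vE; apply: rotatesV; exact: x2.
Qed.

Lemma PwJa s x : Pw s x -> Pw (s + 1) (x ^ a)%g.
Proof.
move=> [Lx x1 x2]; split=> [|z zs|n nM]; first exact: inLinfJ.
  by rewrite gvJa x1//; lia.
by rewrite gvJa; apply: rotates_conj; exact: x2.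
Qed.

Lemma PwJaV s x : Pw s x -> Pw (s - 1) (x ^ a^-1)%g.
Proof.
move=> [Lx x1 x2]; split=> [|z zs|n nM]; first exact: inLinfJ.
  by rewrite gvJaV x1//; lia.
by rewrite gvJaV; apply: rotates_conjV; exact: x2.
Qed.

(** A window holds one integer from each class modulo [M], so vanishing folded lamps force all lamps
    to vanish. The coordinates from [M] on are then trivial, and [Kw] handles those before. *)
Lemma PwK s x : Pw s x -> Kw x -> x = 1%g.
Proof.
move=> [Lx x1 x2] [xc xk xv].
have v0 y : gv x y = 0.
  have [ys|ys] := boolP (s <= y < s + M%:Z); last exact: x1.
  have := xv y; rewrite /foldv (@fold_single _ _ _ y) ?subrr ?dvdz0//.
  move=> z /eqP vz /dvdzP[q zq]; have zs : s <= z < s + M%:Z.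
    by apply/negPn/negP => /x1 e; move: vz; rewrite e eqxx.
  have [q0|q0] := eqVneq q 0; first by move: zq; rewrite q0 mul0r; lia.
  have : 1 * M%:Z <= `|q| * M%:Z :> int by apply: ler_wpM2r => //; lia.
  by rewrite -[M%:Z in X in _ <= X](@ger0_norm int) // -normrM -zq; lia.
apply: Gt_eq => n; have [nM|nM] := ltnP n M; first exact: xc.
apply: rotates_uniq (x2 n nM) (rotates1 _ _ s M) => y _; exact: v0.
Qed.

Definition covers s x := exists2 p, Pw s p & Kw (p^-1 * x)%g.

(** alpha^M is trivial in the lamplighter group over Z/M, so modulo [Kw] only its first [M]
    coordinates count. Its truncation has no lamps and therefore fits every window. *)
Lemma truncated_alpha : exists l, [/\ inLinf l, forall s, Pw s l & Kw (l^-1 * a ^+ M)%g].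
Proof.
have [l Ll lE] := truncation M (a ^+ M)%g.
have [lk lv] : gk l = 0 /\ gv l = fun=> 0.
  by apply: (@germ_eventually1 _ M) => n; rewrite leqNgt => /negbTE nM; rewrite lE nM.
exists l; split=> // [s|].
  split=> // [y _|n]; rewrite lv// leqNgt => /negbTE nM.
  by rewrite lE nM; exact: rotates1.
split=> [n nM||y].
- by rewrite -[LHS]/((sval l n)^-1 * sval (a ^+ M)%g n)%g lE nM mulVg.
- by rewrite gkM gkV lk oppr0 add0r gkX gka natz dvdzz.
- by rewrite foldvM foldvV /foldv lv gvaX !fold0 oppr0 addr0.
Qed.

Lemma Kw_transl x y z : Kw (x^-1 * y)%g -> Kw (y^-1 * z)%g -> Kw (x^-1 * z)%g.
Proof. by move=> h1 h2; have := KwM h1 h2; rewrite -mulgA mulVKg. Qed.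

Lemma PwJaX k s x : Pw s x -> Pw (s + k%:Z) (x ^ (a ^+ k))%g.
Proof.
elim: k => [|k IHk] h; first by rewrite addr0 expg0 conjg1.
have := PwJa (IHk h); rewrite expgSr conjgM.
by rewrite (_ : s + k%:Z + 1 = s + k.+1%:Z)//; lia.
Qed.

Lemma PwJaXV k s x : Pw s x -> Pw (s - k%:Z) (x ^ (a ^- k))%g.
Proof.
elim: k => [|k IHk] h; first by rewrite subr0 expg0 invg1 conjg1.
have := PwJaV (IHk h); rewrite expgS invMg conjgM.
by rewrite (_ : s - k%:Z - 1 = s - k.+1%:Z)//; lia.
Qed.

Lemma Kw_conj_congr g h x : Kw (g^-1 * h)%g -> Kw ((x ^ g)^-1 * x ^ h)%g.
Proof.
move=> gh; have := KwM (KwJ (x ^ g)%g (KwV gh)) gh.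
have -> // : ((g^-1 * h)^-1 ^ (x ^ g) * (g^-1 * h) = (x ^ g)^-1 * x ^ h)%g.
have -> : (x ^ h = (x ^ g) ^ (g^-1 * h))%g by rewrite -conjgM mulVKg.
by move: (g^-1 * h)%g (x ^ g)%g => k u; rewrite /conjg !mulgA.
Qed.

Lemma PwJ s x y : Pw s x -> Pw s y -> Pw s (x ^ y)%g.
Proof. by move=> Px Py; apply: PwM (PwM _ _) => //; exact: PwV. Qed.

(* Conjugation by alpha^M moves the window by M, and agrees modulo [Kw] with
   conjugation by an element of every window group. *)
Lemma covers_shift s x : covers s x -> covers (s + M%:Z) x /\ covers (s - M%:Z) x.
Proof.
move=> [p Pp Kp]; have [l [Ll Pl Kl]] := truncated_alpha.
split.
- exists (p ^ (a ^+ M * l^-1))%g.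
    by rewrite conjgM; apply: PwJ; [exact: PwJaX|exact: PwV].
  apply: Kw_transl Kp; rewrite -[X in (_ * X)%g](conjg1 p).
  apply: Kw_conj_congr; rewrite mulg1.
  have := KwJ l^-1%g (KwV Kl).
  by rewrite /conjg !invMg !invgK !mulgA mulgK.
- exists (p ^ (a ^- M * l))%g; first by rewrite conjgM; apply: PwJ; [exact: PwJaXV|].
  apply: Kw_transl Kp; rewrite -[X in (_ * X)%g](conjg1 p).
  by apply: Kw_conj_congr; rewrite mulg1 invMg invgK.
Qed.

Lemma covers_shiftz s x (q : int) : covers s x -> covers (s + q * M%:Z) x.
Proof.
move=> sx; case: q => [k|k].
  elim: k => [|k /covers_shift[h _]]; first by rewrite mul0r addr0.
  by move: h; rewrite (_ : s + k%:Z * M%:Z + M%:Z = s + k.+1%:Z * M%:Z)//; lia.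
elim: k => [|k /covers_shift[_ h]].
  have [_] := covers_shift sx.
  by rewrite (_ : s - M%:Z = s + Negz 0 * M%:Z)//; lia.
by move: h; rewrite (_ : s + Negz k * M%:Z - M%:Z = s + Negz k.+1 * M%:Z)//; lia.
Qed.

Lemma covers_b s : covers s b.
Proof.
(* The window starting at [- t] contains 0, the only lamp of [b], and differs from the given one by
   a multiple of [M]. *)
pose t := ((- s) %% M)%Z; pose q := ((- s) %/ M)%Z.
have sE : - s = q * M%:Z + t by exact: divz_eq.
have t0 : 0 <= t by rewrite modz_ge0.
have tM : t < M%:Z by rewrite ltz_pmod.
have -> : s = - t + (- q) * M%:Z by lia.
apply: covers_shiftz; exists b; last by rewrite mulVg; exact: Kw1.
split=> [|y ys|n nM]; first exact: L_beta.
  by rewrite gvb /bump0; case: eqP => // y0; move: ys; rewrite y0; lia.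
by rewrite gvb; apply: rotates_cyc3 => //; [lia|have := r_ge n; lia].
Qed.

Lemma coversM s x y : covers s x -> covers s y -> covers s (x * y)%g.
Proof.
move=> [p Pp Kp] [q Pq Kq]; exists (p * q)%g; first exact: PwM.
have := KwM (KwJ q Kp) Kq; rewrite /conjg.
by rewrite invMg -!mulgA mulVKg.
Qed.

Lemma coversV s x : covers s x -> covers s x^-1%g.
Proof.
move=> [p Pp Kp]; exists p^-1%g; first exact: PwV.
have := KwJ p^-1%g (KwV Kp).
by rewrite /conjg !invMg !invgK !mulgA mulgK.
Qed.

(** Conjugation by alpha moves the window by one, so the induction must treat all [s] at once. *)
Lemma covers_inLinf x : inLinf x -> forall s, covers s x.
Proof.
have h1 s : covers s 1%g by exists 1%g; rewrite ?mulVg; [exact: Pw1|exact: Kw1].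
elim=> [||u w _ hu _ hw|u _ hu|g u _ hu]; [exact: covers_b|exact: h1|..].
- by move=> s; exact: coversM.
- by move=> s; exact: coversV.
rewrite -[Gmul (Gmul _ _) _]/(g^-1 * u * g)%g -mulgA -[(_ * _)%g]/(u ^ g)%g.
apply: (@stable_conj (fun x => forall s, covers s x)) hu => {u}.
- move=> u hu s; have [p Pp Kp] := hu (s - 1); exists (p ^ a)%g.
    by rewrite -(subrK 1 s); exact: PwJa.
  by rewrite -conjVg -conjMg; exact: KwJ.
- move=> u hu s; have [p Pp Kp] := hu (s + 1); exists (p ^ a^-1)%g.
    by rewrite -(addrK 1 s); exact: PwJaV.
  by rewrite -conjVg -conjMg; exact: KwJ.
- exact: covers_b.
- by move=> u w hu hw s; exact: coversM.
- by move=> u hu s; exact: coversV.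
Qed.

(** The j-th window is [j - M, j); with this offset, every fixed interval around 0 lies in the
    windows whose [j] is far from 0 and from [M]. *)
Lemma neumann_level :
  level [set x | inLinf x] a M Kw (fun j : nat => Pw (j%:Z - M%:Z)).
Proof.
split.
- exact: Kw1.
- exact: KwM.
- exact: KwV.
- by move=> x g Kx; rewrite -mulgA; exact: KwJ.
- exact: Kw_finite.
- by move=> j; exact: Pw1.
- by move=> j; exact: PwM.
- by move=> j; exact: PwV.
- by move=> j x [].
- move=> j x; split=> h.
    have := PwJaV h; rewrite /conjg invgK mulgA.
    by rewrite (_ : j.+1%:Z - M%:Z - 1 = j%:Z - M%:Z)//; lia.
  have := PwJa h; rewrite /conjg !mulgA mulVg mul1g mulgVK.
  by rewrite (_ : j%:Z - M%:Z + 1 = j.+1%:Z - M%:Z)//; lia.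
- by move=> j x; exact: PwK.
- by move=> j x Lx; exact: covers_inLinf.
- by have [l [Ll _ Kl]] := truncated_alpha; exists l.
Qed.

End one_window.

(** * Exhaustion of L by the windows, and the conclusion *)

Lemma window_exhaust x : inLinf x -> exists c, forall m j,
  (c <= j)%N -> (j + c <= m)%N -> Pw m (j%:Z - m.+1%:Z) x.
Proof.
move=> Lx; have [_ [B [x1 x2]]] := local_inLinf Lx.
(* The extra 1 is for the half-open window: [-B, B] must lie strictly below its right end [j]. *)
exists B.+1 => m j Bj jm; split=> // [y ys|n nm]; first by apply: x1; lia.
by apply: x2; [lia|lia|have := r_ge n; lia].
Qed.

(** Elements of the window groups have translation part 0, so congruence modulo [Kw] would make [M]
    divide the nonzero integer [gk x], impossible once M > |gk x|. *)
Lemma outside_window x : ~ inLinf x -> exists N, forall m (j : nat) p,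
  (N <= m)%N -> Pw m (j%:Z - m.+1%:Z) p -> ~ Kw m (p^-1 * x)%g.
Proof.
move=> nLx; exists `|gk x|%N => m j p xm [Lp _ _] [_ + _].
rewrite gkM gkV gk_inLinf// oppr0 add0r dvdzE => /dvdn_leq.
have x0 : gk x <> 0 by move=> /gk0_inLinf.
by lia.
Qed.

Theorem neumann_cosofic (R : realType) (mu : probability (BorelSp G) R) :
  IRS (@Gmul d r) (@Ginv d r) (Gone d r) mu ->
  mu [set H | is_subgroup (@Gmul d r) (@Ginv d r) (Gone d r) H /\
              forall g, H g -> inLinf g] = 1%E ->
  cosofic (@Gmul d r) (@Ginv d r) (Gone d r) mu.
Proof.
apply: (@cosofic_of_levels G R [set x | inLinf x] a Kw
  (fun m (j : nat) => Pw m (j%:Z - m.+1%:Z))).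
- move=> S Sa SL SM SV; apply: Gt_ind_gen => //; apply: SL.
    exact: L_beta.
  exact: inLinf1.
- exact: neumann_level.
- exact: window_exhaust.
- exact: outside_window.
Qed.

End neumann_group.

Theorem theorem4p4 (R : realType) (d r : nat -> nat)
  (hd_mono : forall m n, (m <= n)%N -> (d m <= d n)%N)
  (hd_prime : forall n, prime (d n))
  (hd_ge5 : forall n, (5 <= d n)%N)
  (hr_pos : forall n, (0 < r n)%N)
  (hr_incr : forall m n, (m < n)%N -> (r m < r n)%N)
  (hrd : forall n, (3 * r n <= d n)%N)
  (mu : probability (BorelSp (Gt d r)) R)
  (hmu : ergodic_IRS (@Gmul d r) (@Ginv d r) (Gone d r) mu)
  (hsupp : mu [set H | is_subgroup (@Gmul d r) (@Ginv d r) (Gone d r) H /\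
                       forall g, H g -> inLinf g] = 1%E) :
  cosofic (@Gmul d r) (@Ginv d r) (Gone d r) mu.
Proof. exact: neumann_cosofic hmu.1 hsupp. Qed.
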